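(* Let $\mathcal{C}=\bigsqcup_{L\in\operatorname{GL}_{2d}(\mathbb{R})}A_L$ with projection $\rho:\mathcal{C}\to\operatorname{GL}_{2d}(\mathbb{R})$, $\rho^{-1}(L)=A_L$. Regard each $\mathbf{a}\in\ell^1_\nu(\mathbb{Z}^{2d})$ as the constant section $L\mapsto\mathbf{a}\in A_L$ of $\rho$. Then these sections satisfy: (1) for each $\mathbf{a}\in\ell^1_\nu(\mathbb{Z}^{2d})$ the map $L\mapsto\|\mathbf{a}\|_{A_L}$ is continuous, and (2) for each $L$ the space $\ell^1_\nu(\mathbb{Z}^{2d})$ is dense in $A_L$; and $\rho$ becomes a $C^*$-bundle over $\operatorname{GL}_{2d}(\mathbb{R})$ when $\mathcal{C}$ is equipped with the topology having as basis the sets $$W(\mathbf{a},U,\varepsilon)=\{\mathbf{s}\in\mathcal{C}:\rho(\mathbf{s})\in U,\ \|\mathbf{s}-\mathbf{a}\|_{A_{\rho(\mathbf{s})}}<\varepsilon\},\quad \mathbf{a}\in\ell^1_\nu(\mathbb{Z}^{2d}),\ U\subseteq\operatorname{GL}_{2d}(\mathbb{R})\text{ open},\ \varepsilon>0,$$ which is the unique topology making $\rho$ a Banach bundle for which all the constant sections $\mathbf{a}\in\ell^1_\nu(\mathbb{Z}^{2d})$ are continuous. As a consequence, a section $\mathfrak{a}\in\prod_{L\in\operatorname{GL}_{2d}(\mathbb{R})}A_L$ is continuous if and only if for all $\varepsilon>0$ and $L_0\in\operatorname{GL}_{2d}(\mathbb{R})$ there exist $\mathbf{a}_0\in\ell^1_\nu(\mathbb{Z}^{2d})$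 and an open neighborhood $U_0$ of $L_0$ such that $$\|\mathfrak{a}(L)-\mathbf{a}_0\|_{A_L}<\varepsilon\qquad\text{for all }L\in U_0.$$
   Context: Fix $d\ge1$. $\operatorname{GL}_{2d}(\mathbb{R})$ carries its usual topology. Let $c(z_1,z_2)=e^{-2\pi i\,x_1\cdot\omega_2}$ for $z_i=(x_i,\omega_i)\in\mathbb{R}^d\times\mathbb{R}^d$ and $c_L(k,m)=c(Lk,Lm)$ for $k,m\in\mathbb{Z}^{2d}$. $A_L$ is the enveloping $C^*$-algebra of the Banach $*$-algebra $\ell^1(\mathbb{Z}^{2d})$ with product $(a_1*a_2)(n)=\sum_{k}a_1(k)a_2(n-k)c_L(k,n-k)$ and involution $a^*(n)=\overline{a(-n)}\,c_L(n,n)$. With the time-frequency shifts $(\pi(x,\omega)f)(t)=e^{2\pi i\,t\cdot\omega}f(t-x)$ on $L^2(\mathbb{R}^d)$, the norm of $A_L$ satisfies $\|\mathbf{a}\|_{A_L}=\bigl\|\sum_{k\in\mathbb{Z}^{2d}}a(k)\pi(Lk)\bigr\|$ (operator norm on $L^2(\mathbb{R}^d)$) for $\mathbf{a}\in\ell^1(\mathbb{Z}^{2d})$, and $\ell^1(\mathbb{Z}^{2d})$ is densely contained in $A_L$. The weight is $\nu(k)=1+\sum_i|k_i|$ and $\ell^1_\nu(\mathbb{Z}^{2d})=\{\mathbf{a}:\|\mathbf{a}\|_{\ell^1_\nu}=\sum_k|a(k)|\nu(k)<\infty\}\subseteq\ell^1(\mathbb{Z}^{2d})$. A Banach bundle over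 a Hausdorff space $X$ is an open continuous surjection $\rho:\mathcal{B}\to X$ from a Hausdorff space $\mathcal{B}$ with a Banach space structure on each fiber $\mathcal{B}_x=\rho^{-1}(x)$ such that: $s\mapsto\|s\|$ is continuous on $\mathcal{B}$; addition is continuous on $\{(s,t):\rho(s)=\rho(t)\}$; for each $\lambda\in\mathbb{C}$, $s\mapsto\lambda s$ is continuous; and if $(s_i)$ is a net with $\rho(s_i)\to x$ and $\|s_i\|\to0$, then $s_i\to0_x$ (the zero of $\mathcal{B}_x$). It is a $C^*$-bundle if every fiber is a $C^*$-algebra and multiplication (on $\{(s,t):\rho(s)=\rho(t)\}$) and involution are continuous. A section is a map $\gamma:X\to\mathcal{B}$ with $\gamma(x)\in\mathcal{B}_x$ for all $x$. *)

(* Defs.v *)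
From HB Require Import structures.
From mathcomp Require Import all_boot all_order all_algebra.
From mathcomp Require Import complex.
From mathcomp Require Import all_classical all_reals all_analysis.
Import Order.TTheory GRing.Theory Num.Theory numFieldNormedType.Exports.

Set Implicit Arguments.
Unset Strict Implicit.
Unset Printing Implicit Defensive.

Local Open Scope classical_set_scope.
Local Open Scope ring_scope.

(* Norms over R[i] are R[i]-valued in the library; [rnorm] is the same number
   seen in R. *)
Definition rnorm (R : realType) (V : normedZmodType R[i]) (x : V) : R :=
  complex.Re `|x|.

(* C*-algebras are not assumed to be unital, hence are not built on the
   (unital) ring structures of the library. *)
HB.mixin Record isCstarAlgebra (R : realType) A
    of CompleteNormedModule R[i] A := {
  cmul : A -> A -> A ;
  cstar : A -> A ;
  cmulA : associative cmul ;
  cmulDl : left_distributive cmul +%R ;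
  cmulDr : right_distributive cmul +%R ;
  cmulZl : forall (l : R[i]) (x y : A), cmul (l *: x) y = l *: cmul x y ;
  cmulZr : forall (l : R[i]) (x y : A), cmul x (l *: y) = l *: cmul x y ;
  cmul_norm : forall x y : A, `|cmul x y| <= `|x| * `|y| ;
  cstarK : involutive cstar ;
  cstarD : {morph cstar : x y / x + y} ;
  cstarZ : forall (l : R[i]) (x : A), cstar (l *: x) = l^* *: cstar x ;
  cstarM : forall x y : A, cstar (cmul x y) = cmul (cstar y) (cstar x) ;
  cstar_norm : forall x : A, `|cmul (cstar x) x| = `|x| ^+ 2
}.

#[short(type="cstarAlgType")]
HB.structure Definition CstarAlgebra (R : realType) :=
  {A of CompleteNormedModule R[i] A & isCstarAlgebra R A}.

(* A topology on T as a datum, so that one can quantify over the topologies of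
   a fixed type; [tspace tau] is T seen as the corresponding topological
   space. *)
Record topology (T : Type) := Topology {
  opens : set (set T) ;
  opensT : opens setT ;
  opensI : setI_closed opens ;
  opens_bigU : forall (I : Type) (f : I -> set T),
    (forall i, opens (f i)) -> opens (\bigcup_i f i)
}.

Definition tspace (T : Type) (tau : topology T) : Type := T.

Section tspace_topological.
Variables (T : Type) (tau : topology T).
HB.instance Definition _ := gen_eqMixin (tspace tau).
HB.instance Definition _ := gen_choiceMixin (tspace tau).
HB.instance Definition _ := isOpenTopological.Build (tspace tau)
  (opensT tau) (@opensI T tau) (@opens_bigU T tau).
End tspace_topological.

Section banach_bundles.
Variables (R : realType) (X : topologicalType).

(* A bundle is given by the family E of its fibers; its total space is the
   sigma type of E and its projection is projT1. The library's own (disjoint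
   union) topology on sigma types plays no role: the total space is always
   used through [tspace]. *)
Section bundles.
Variable E : X -> completeNormedModType R[i].

Definition total_space : Type := {x : X & E x}.

Definition in_total (x : X) (s : E x) : total_space := existT _ x s.

Definition rho (s : total_space) : X := projT1 s.

Definition total_norm (s : total_space) : R := rnorm (projT2 s).

(* Pairs of elements of the same fiber, and their inclusion in the product
   of two copies of the total space. *)
Definition fiber_pairs : Type := {x : X & (E x * E x)%type}.

Definition fiber_pairs_incl (tau : topology total_space) (p : fiber_pairs) :
    tspace tau * tspace tau :=
  (in_total (projT2 p).1, in_total (projT2 p).2).

HB.instance Definition _ := gen_eqMixin fiber_pairs.
HB.instance Definition _ := gen_choiceMixin fiber_pairs.

(* Continuity, on {(s, t) | rho s = rho t} with the topology induced by the
   product topology, of a fiberwise binary operation. *)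
Definition fiberwise_continuous (tau : topology total_space)
    (op : forall x, E x -> E x -> E x) : Prop :=
  continuous ((fun p : fiber_pairs =>
      in_total (op (projT1 p) (projT2 p).1 (projT2 p).2))
    : initial_topology (fiber_pairs_incl tau) -> tspace tau).

(* Nets are families indexed by a type with a proper filter, as is usual in
   the library. *)
Record is_banach_bundle (tau : topology total_space) : Prop :=
    IsBanachBundle {
  bundle_base_hausdorff : hausdorff_space X ;
  bundle_hausdorff : hausdorff_space (tspace tau) ;
  bundle_rho_continuous : continuous (rho : tspace tau -> X) ;
  bundle_rho_open : forall O : set (tspace tau), open O -> open (rho @` O) ;
  bundle_rho_surj : forall x : X, exists s : total_space, rho s = x ;
  bundle_norm_continuous : continuous (total_norm : tspace tau -> R) ;
  bundle_add_continuous : fiberwise_continuous tau (fun x s t => s + t) ;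
  bundle_scale_continuous : forall l : R[i],
    continuous ((fun s : total_space => in_total (l *: projT2 s))
                : tspace tau -> tspace tau) ;
  bundle_zero : forall (I : Type) (F : set_system I) (s : I -> tspace tau)
      (x : X), ProperFilter F ->
    (fun i => rho (s i)) @ F --> x ->
    (fun i => total_norm (s i)) @ F --> (0 : R) ->
    s @ F --> (in_total (0 : E x) : tspace tau)
}.

Definition continuous_section (tau : topology total_space)
    (gamma : forall x, E x) : Prop :=
  continuous ((fun x => in_total (gamma x)) : X -> tspace tau).

End bundles.

Record is_cstar_bundle (A : X -> cstarAlgType R)
    (tau : topology (total_space A)) : Prop := IsCstarBundle {
  cstar_bundle_banach : is_banach_bundle tau ;
  cstar_bundle_mul : fiberwise_continuous tau (fun x (s t : A x) => cmul s t) ;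
  cstar_bundle_star :
    continuous ((fun s : total_space A =>
                   in_total (cstar (projT2 s) : A (projT1 s)))
                : tspace tau -> tspace tau)
}.

End banach_bundles.

Definition GL (R : realType) (n : nat) : topologicalType :=
  set_type [set L : 'M[R]_n | L \in unitmx].

(* Z^{2d}; a vector of R^{2d} is z = (x, omega) with x = usubmx z and
   omega = dsubmx z. *)
Definition lattice (d : nat) := 'cV[int]_(d + d).

Section twisted_l1.
Variables (R : realType) (d : nat).
Implicit Types (a b : lattice d -> R[i]) (k m n : lattice d).

(* e^{2 pi i t} *)
Definition cexp2pi (t : R) : R[i] :=
  Complex (cos (2 * pi * t)) (sin (2 * pi * t)).

Definition cocycle (z1 z2 : 'cV[R]_(d + d)) : R[i] :=
  cexp2pi (- \sum_(i < d) usubmx z1 i ord0 * dsubmx z2 i ord0).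

Definition lattice_cocycle (L : 'M[R]_(d + d)) k m : R[i] :=
  cocycle (L *m map_mx intr k) (L *m map_mx intr m).

(* Sum of an absolutely summable family (junk value otherwise). *)
Definition rsum (I : choiceType) (f : I -> R) : R :=
  fine (\esum_(i in [set: I]) ((EFin \o f)^\+ i)%E)
  - fine (\esum_(i in [set: I]) ((EFin \o f)^\- i)%E).

Definition csum (I : choiceType) (f : I -> R[i]) : R[i] :=
  Complex (rsum (fun i => complex.Re (f i))) (rsum (fun i => complex.Im (f i))).

Definition l1 : set (lattice d -> R[i]) :=
  [set a | (\esum_(k in [set: lattice d]) (complex.Re `|a k|)%:E < +oo)%E].

Definition nu k : R := 1 + \sum_(i < d + d) `|(k i ord0)%:~R|.

Definition l1nu : set (lattice d -> R[i]) :=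
  [set a | (\esum_(k in [set: lattice d])
              (complex.Re `|a k| * nu k)%:E < +oo)%E].

Definition twisted_conv (L : 'M[R]_(d + d)) a b : lattice d -> R[i] :=
  fun n => csum (fun k => a k * b (n - k) * lattice_cocycle L k (n - k)).

Definition twisted_star (L : 'M[R]_(d + d)) a : lattice d -> R[i] :=
  fun n => (a (- n))^* * lattice_cocycle L n n.

(* A Hilbert space is a complete normed space whose norm comes from an inner
   product (linear in its first argument). *)
Definition is_inner_product (H : normedModType R[i]) (ip : H -> H -> R[i]) :
    Prop :=
  [/\ forall (l : R[i]) (x y z : H), ip (l *: x + y) z = l * ip x z + ip y z,
      forall x y, ip y x = (ip x y)^*
    & forall x, ip x x = `|x| ^+ 2].

(* *-representations of l^1 with the twisted operations, by bounded operators.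
   Elements of l^1 are functions satisfying [l1]; the values of P outside of
   [l1] are irrelevant. *)
Record is_star_rep (L : 'M[R]_(d + d)) (H : normedModType R[i])
    (ip : H -> H -> R[i]) (P : (lattice d -> R[i]) -> H -> H) : Prop :=
  IsStarRep {
  rep_op_linear : forall a, l1 a -> linear (P a) ;
  rep_op_bounded : forall a, l1 a ->
    exists M : R, forall x, rnorm (P a x) <= M * rnorm x ;
  rep_linear : forall (l : R[i]) a b, l1 a -> l1 b ->
    forall x, P (fun k => l * a k + b k) x = l *: P a x + P b x ;
  rep_mul : forall a b, l1 a -> l1 b ->
    forall x, P (twisted_conv L a b) x = P a (P b x) ;
  rep_star : forall a, l1 a ->
    forall x y, ip (P a x) y = ip x (P (twisted_star L a) y)
}.

(* The supremum of the operator norms of P a over all *-representations P on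
   Hilbert spaces. *)
Definition universal_norm (L : 'M[R]_(d + d)) a : R :=
  sup [set r | exists (H : completeNormedModType R[i]) (ip : H -> H -> R[i])
                      (P : (lattice d -> R[i]) -> H -> H) (x : H),
         [/\ is_inner_product ip, is_star_rep L ip P, rnorm x <= 1
           & r = rnorm (P a x)]].

(* A, with iota, is the enveloping C*-algebra of l^1 with the operations
   twisted by L: the (Hausdorff) completion of l^1 for the universal norm. *)
Record is_enveloping (L : 'M[R]_(d + d)) (A : cstarAlgType R)
    (iota : (lattice d -> R[i]) -> A) : Prop := IsEnveloping {
  env_linear : forall (l : R[i]) a b, l1 a -> l1 b ->
    iota (fun k => l * a k + b k) = l *: iota a + iota b ;
  env_mul : forall a b, l1 a -> l1 b ->
    iota (twisted_conv L a b) = cmul (iota a) (iota b) ;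
  env_star : forall a, l1 a -> iota (twisted_star L a) = cstar (iota a) ;
  env_norm : forall a, l1 a -> rnorm (iota a) = universal_norm L a ;
  env_dense : dense (iota @` l1)
}.

End twisted_l1.

Arguments l1 {R d}.
Arguments l1nu {R d}.

Section the_bundle.
Variables (R : realType) (d : nat) (A : GL R (d + d) -> cstarAlgType R).
Variable iota : forall L, (lattice d -> R[i]) -> A L.

(* The set W(a, U, eps), with [l1nu] embedded in the fibers by iota. *)
Definition Wset (a : lattice d -> R[i]) (U : set (GL R (d + d))) (eps : R) :
    set (total_space A) :=
  [set s | U (rho s) /\ rnorm (projT2 s - iota (projT1 s) a) < eps].

Definition Wsets : set (set (total_space A)) :=
  [set W | exists a U eps,
    [/\ l1nu a, open U, 0 < eps & W = Wset a U eps]].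

End the_bundle.

(* Main.v *)
Require Import Defs.
From HB Require Import structures.
From mathcomp Require Import all_boot all_order all_algebra finmap.
From mathcomp Require Import complex ring lra.
From mathcomp Require Import all_classical all_reals all_analysis.
Import Order.TTheory GRing.Theory Num.Theory numFieldNormedType.Exports.

Set Implicit Arguments.
Unset Strict Implicit.
Unset Printing Implicit Defensive.

Local Open Scope classical_set_scope.
Local Open Scope ring_scope.

(** The heart of the matter is the continuity of [L |-> ||a||_(A_L)]; the rest is
    Fell's construction of a bundle from a linear space of sections.

    Continuity of the norm. Let [P] be a *-representation on [H] of l1 twisted
    by [L], and let [V_k] be the image of the point mass at [k]. For another
    matrix [L'] the quotient [delta = c_L' / c_L] is again a bicharacter, and on
    the Hilbert space of square summable [H]-valued families on the lattice the
    operators [(W_k f)(n) = delta(k, n - k) V_k f(n - k)], which are the tensor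
    product of [V_k] with a twisted translation, obey the commutation rules of
    [L'] ([twist_mul], [twist_adj]). They integrate to a representation [P'] of
    l1 twisted by [L'] ([integrated_star_rep]). The lattice is amenable: the
    weights [phi(n) = q ^ |n|] with [q] close to 1 are almost invariant under
    translations ([almost_invariant_vector]). When [delta] is close to 1 on a
    large finite set, [P'(a)] therefore nearly maps [x (x) phi] to
    [P(a) x (x) phi] ([twist_tensor]), so [||P'(a)|| >= ||P(a)|| - eps]. The
    finite set and the required closeness depend on [a] and [eps] only, and
    the roles of [L] and [L'] may be exchanged: this gives both semicontinuities
    ([universal_norm_close], [iota_norm_continuous]).

    A representation is only assumed to map each element of l1 to a bounded
    operator. That it is a contraction for the l1 norm ([rep_norm_le]) follows
    from Neumann series in l1; it makes the supremum defining the universal norm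
    meaningful, lets [P(a)] be recovered as the sum of the [a(k) V_k]
    ([l1_expansion]), and makes finitely supported elements dense in every
    [A_L], uniformly in [L] ([iota_truncation]).

    The bundle. If a linear space of sections has continuous norms and is dense
    in each fiber, the tubes around sections form the basis of a Banach bundle
    topology ([fell_banach_bundle]), the only one for which the sections are
    continuous ([fell_unique]). Product and involution are continuous as soon as
    the product and the adjoint of sections can be approximated by sections near
    every point ([fell_cstar_bundle]). Products of constant sections are not
    constant, since the coefficients [c_L(k, m)] vary with [L]; but after a
    truncation to finite supports finitely many coefficients remain, and these
    may be frozen at a given [L0] ([iota_mul_near], [iota_star_near]). *)

(** * The real norm of complex normed spaces *)

(* The norms occurring in a goal may be typed through different structure
   paths; abstracting them up to conversion lets lra identify them. *)
Ltac rnlra := repeat match goal with |- context [@rnorm ?R ?V ?x] =>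
  let a := fresh "a" in set a := (@rnorm R V x); clearbody a end; lra.

Section real_norm.
Variable R : realType.
Implicit Types (V : normedZmodType R[i]).

Lemma rnormE V (x : V) : real_complex R (rnorm x) = `|x|.
Proof. by rewrite /rnorm RRe_real // normr_real. Qed.

Lemma le_norm_rnorm V (x : V) (e : R) : (`|x| <= real_complex R e) = (rnorm x <= e).
Proof. by rewrite -!rnormE lecR. Qed.

Lemma lt_norm_rnorm V (x : V) (e : R) : (`|x| < real_complex R e) = (rnorm x < e).
Proof. by rewrite -!rnormE ltcR. Qed.

Lemma rnorm_ge0 V (x : V) : 0 <= rnorm x.
Proof. by rewrite -lecR rnormE normr_ge0. Qed.

Lemma rnorm0 V : rnorm (0 : V) = 0.
Proof. by rewrite /rnorm normr0. Qed.

Lemma rnorm0_eq0 V (x : V) : rnorm x = 0 -> x = 0.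
Proof. by move=> x0; apply/normr0_eq0; rewrite -rnormE x0. Qed.

Lemma rnormN V (x : V) : rnorm (- x) = rnorm x.
Proof. by rewrite /rnorm normrN. Qed.

Lemma rdistC V (x y : V) : rnorm (x - y) = rnorm (y - x).
Proof. by rewrite -rnormN opprB. Qed.

Lemma rnormD V (x y : V) : rnorm (x + y) <= rnorm x + rnorm y.
Proof. by rewrite -lecR rmorphD /= !rnormE ler_normD. Qed.

Lemma rnormB V (x y : V) : rnorm (x - y) <= rnorm x + rnorm y.
Proof. by rewrite -[rnorm y]rnormN rnormD. Qed.

Lemma rdist_tri V (x y z : V) : rnorm (x - z) <= rnorm (x - y) + rnorm (y - z).
Proof. by rewrite -[x - z](subrKA y) rnormD. Qed.

Lemma ler_rdist V (x y : V) : `|rnorm x - rnorm y| <= rnorm (x - y).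
Proof.
rewrite ler_norml; apply/andP; split.
  by have := rnormB x (x - y); rewrite subKr; lra.
by have := rnormD (x - y) y; rewrite subrK; lra.
Qed.

Lemma rnorm_sum V (I : Type) (r : seq I) (P : pred I) (F : I -> V) :
  rnorm (\sum_(i <- r | P i) F i) <= \sum_(i <- r | P i) rnorm (F i).
Proof.
elim/big_ind2 : _ => [|x1 x2 y1 y2 h1 h2|//]; first by rewrite rnorm0.
by rewrite (le_trans (rnormD _ _)) // lerD.
Qed.

Lemma rnormZ (V : normedModType R[i]) (l : R[i]) (x : V) :
  rnorm (l *: x) = rnorm l * rnorm x.
Proof. by apply: complexI; rewrite rmorphM /= !rnormE normrZ. Qed.

Lemma rnormM (x y : R[i]) : rnorm (x * y) = rnorm x * rnorm y.
Proof. by apply: complexI; rewrite rmorphM /= !rnormE normrM. Qed.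

Lemma rnorm1 : rnorm (1 : R[i]) = 1.
Proof. by apply: complexI; rewrite rnormE normr1. Qed.

Lemma rnormJ (x : R[i]) : rnorm (x^*) = rnorm x.
Proof. by rewrite /rnorm norm_conjC. Qed.

Lemma rnorm_real (x : R) : rnorm (real_complex R x) = `|x|.
Proof.
by rewrite /rnorm normc_def /= expr0n /= addr0 sqrtr_sqr.
Qed.

Lemma le_Re_rnorm (x : R[i]) : `|complex.Re x| <= rnorm x.
Proof. by rewrite -lecR rnormE normc_ge_Re. Qed.

Lemma rnorm_ReIm (x : R[i]) : rnorm x <= `|complex.Re x| + `|complex.Im x|.
Proof.
have := rnormD (real_complex R (complex.Re x)) ('i%C * real_complex R (complex.Im x)).
rewrite -complexE rnormM !rnorm_real (_ : rnorm 'i%C = 1) ?mul1r //.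
by rewrite /rnorm normc_def /= expr0n expr1n add0r sqrtr1.
Qed.

Lemma le_Im_rnorm (x : R[i]) : `|complex.Im x| <= rnorm x.
Proof.
have := le_Re_rnorm (x * 'i%C); rewrite ReiNIm normrN rnormM.
suff -> : rnorm ('i%C : R[i]) = 1 by rewrite mulr1.
by rewrite /rnorm normc_def /= expr0n expr1n add0r sqrtr1.
Qed.

Lemma gt0_realP (e : R[i]) : 0 < e -> exists2 r : R, 0 < r & e = real_complex R r.
Proof.
case: e => a b; rewrite ltcE /= => /andP[/eqP b0 a0].
by exists a => //; rewrite b0.
Qed.

Lemma ball_rnorm (V : normedModType R[i]) (x y : V) (r : R) :
  ball x (real_complex R r) y <-> rnorm (x - y) < r.
Proof. by rewrite -ball_normE /= lt_norm_rnorm. Qed.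

Lemma cvg_rnormP (V : normedModType R[i]) (T : Type) (F : set_system T)
    (f : T -> V) l : Filter F ->
  f x @[x --> F] --> l <->
  forall e : R, 0 < e -> \forall x \near F, rnorm (l - f x) < e.
Proof.
move=> FF; split=> [/cvgrPdist_lt h e e0|h].
  have /h : 0 < real_complex R e by rewrite ltcR.
  by apply: filterS => x; rewrite lt_norm_rnorm.
apply/cvgrPdist_lt => _ /gt0_realP[e e0 ->].
by have := h _ e0; apply: filterS => x; rewrite lt_norm_rnorm.
Qed.

Lemma cvg_rnorm (V : normedModType R[i]) (T : Type) (F : set_system T)
    (f : T -> V) l : Filter F -> f x @[x --> F] --> l ->
  rnorm (f x) @[x --> F] --> rnorm l.
Proof.
move=> FF /cvg_rnormP h; apply/cvgrPdist_lt => e e0.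
by have := h e e0; apply: filterS => x; apply: le_lt_trans; exact: ler_rdist.
Qed.

Lemma conj_real (t : R) : (real_complex R t)^* = real_complex R t.
Proof. exact: conjc_real. Qed.

Lemma mul_conj_rnorm (z : R[i]) : z * z^* = real_complex R (rnorm z ^+ 2).
Proof. by rewrite -normCK rmorphXn /= rnormE. Qed.

End real_norm.

(** * Unordered sums *)
Section finite_sums.
Variables (R : realType) (I : choiceType).
Implicit Types (F G : {fset I}) (u : I -> R) (V : normedZmodType R[i]).

(** For nonnegative [u], a bound on the total sum that stays inside [R]. *)
Definition sum_le u (M : R) := forall F, \sum_(i <- F) u i <= M.

(** Convergence of the partial sums along the directed set of finite index
    sets. *)
Definition has_sum V (x : I -> V) (s : V) :=
  forall e : R, 0 < e -> exists F, forall G, (F `<=` G)%fset ->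
    rnorm (s - \sum_(i <- G) x i) <= e.

Lemma big_fset_sub (W : nmodType) (x : I -> W) F G : (F `<=` G)%fset ->
  \sum_(i <- G) x i = \sum_(i <- F) x i + \sum_(i <- (G `\` F)%fset) x i.
Proof.
move=> FG; rewrite (big_fsetID _ (mem F)) /=; congr (_ + _); apply: eq_fbigl => i.
  by rewrite !inE /= andb_idl // => /(fsubsetP FG).
by rewrite !inE /= andbC.
Qed.

Lemma fdisjointXD F G : [disjoint F & (G `\` F)%fset]%fset.
Proof. by apply/fdisjointP => i iF; rewrite in_fsetD iF. Qed.

Lemma big_fsetU_disj (W : nmodType) (x : I -> W) F G : [disjoint F & G]%fset ->
  \sum_(i <- (F `|` G)%fset) x i = \sum_(i <- F) x i + \sum_(i <- G) x i.
Proof.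
move=> FG; rewrite (big_fset_sub _ (fsubsetUl F G)); congr (_ + _).
apply: eq_fbigl => i; rewrite !inE; have := fdisjointP FG i.
by case: (i \in F) => //= /(_ isT)/negPf.
Qed.

Lemma sum_le_ge0 u M : sum_le u M -> 0 <= M.
Proof. by move=> /(_ fset0); rewrite big_seq_fset0. Qed.

Lemma sum_le_trans u M N : sum_le u M -> M <= N -> sum_le u N.
Proof. by move=> h MN F; rewrite (le_trans (h F)). Qed.

Lemma sum_le_mono u v M : (forall i, u i <= v i) -> sum_le v M -> sum_le u M.
Proof. by move=> uv vM F; rewrite (le_trans _ (vM F)) // ler_sum. Qed.

Lemma sum_leD u v M N : sum_le u M -> sum_le v N ->
  sum_le (fun i => u i + v i) (M + N).
Proof. by move=> uM vN F; rewrite big_split lerD. Qed.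

Lemma sum_leZ u c M : 0 <= c -> sum_le u M -> sum_le (fun i => c * u i) (c * M).
Proof. by move=> c0 uM F; rewrite -mulr_sumr ler_wpM2l. Qed.

Lemma sum_le1 u M i : sum_le u M -> u i <= M.
Proof. by move=> /(_ [fset i]%fset); rewrite big_seq_fset1. Qed.

Lemma ler_sum_fset u F G : (forall i, 0 <= u i) -> (F `<=` G)%fset ->
  \sum_(i <- F) u i <= \sum_(i <- G) u i.
Proof.
by move=> u0 FG; rewrite (big_fset_sub _ FG) lerDl sumr_ge0.
Qed.

(** Any finite set whose partial sum is within [e] of the supremum of the
    partial sums will do. *)
Lemma sum_le_tail u M : (forall i, 0 <= u i) -> sum_le u M ->
  forall e, 0 < e -> exists F, forall G, [disjoint F & G]%fset ->
    \sum_(i <- G) u i <= e.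
Proof.
move=> u0 uM e e0; pose S := range (fun F => \sum_(i <- F) u i).
have S0 : S !=set0 by exists (\sum_(i <- fset0) u i); exists fset0.
have Sub : has_ubound S by exists M => _ [F _ <-].
have [_ [F _ <-] hF] := sup_adherent e0 (conj S0 Sub).
exists F => G FG; have : \sum_(i <- (F `|` G)%fset) u i <= sup S.
  by apply: ub_le_sup => //; exists (F `|` G)%fset.
rewrite big_fsetU_disj //; rewrite -/S in hF *; lra.
Qed.

Lemma has_sum_unique V (x : I -> V) s t : has_sum x s -> has_sum x t -> s = t.
Proof.
move=> xs xt; apply/eqP; rewrite -subr_eq0; apply/eqP; apply: rnorm0_eq0.
apply/eqP; rewrite eq_le rnorm_ge0 andbT; apply/ler_addgt0Pr => e e0.
have e20 : 0 < e / 2 by rewrite divr_gt0.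
have [F hF] := xs _ e20; have [G hG] := xt _ e20; rewrite add0r.
pose H := (F `|` G)%fset.
have := hF H (fsubsetUl _ _); have := hG H (fsubsetUr _ _).
have := rdist_tri s (\sum_(i <- H) x i) t.
rewrite [rnorm (t - _)]rdistC; rnlra.
Qed.

Lemma has_sumD V (x y : I -> V) s t : has_sum x s -> has_sum y t ->
  has_sum (fun i => x i + y i) (s + t).
Proof.
move=> xs yt e e0; have e20 : 0 < e / 2 by rewrite divr_gt0.
have [F hF] := xs _ e20; have [G hG] := yt _ e20.
exists (F `|` G)%fset => H; rewrite fsubUset => /andP[/hF h1 /hG h2].
rewrite big_split /= opprD addrACA.
have := rnormD (s - \sum_(i <- H) x i) (t - \sum_(i <- H) y i); lra.
Qed.

Lemma has_sum_map V (W : normedZmodType R[i]) (f : V -> W) (C : R)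
    (x : I -> V) s :
  {morph f : x y / x + y} -> (forall v, rnorm (f v) <= C * rnorm v) ->
  has_sum x s -> has_sum (f \o x) (f s).
Proof.
move=> fD fC xs e e0; have C0 : 0 < Num.max C 1 by rewrite lt_max ltr01 orbT.
have f0 : f 0 = 0.
  by apply: rnorm0_eq0; apply/eqP; rewrite eq_le rnorm_ge0 (le_trans (fC 0))// rnorm0 mulr0.
have fN v : f (- v) = - f v.
  by apply/eqP; rewrite -subr_eq0 opprK -fD addNr f0.
have [F hF] := xs (e / Num.max C 1) (divr_gt0 e0 C0).
exists F => G /hF h; have -> : \sum_(i <- G) (f \o x) i = f (\sum_(i <- G) x i).
  by rewrite (big_morph f fD f0).
rewrite -fN -fD (le_trans (fC _)) // (le_trans (ler_wpM2r (rnorm_ge0 _) (_ : C <= Num.max C 1))) ?le_max ?lexx//.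
by rewrite -ler_pdivlMl // mulrC.
Qed.

Lemma has_sum_finite V (x : I -> V) F : (forall i, i \notin F -> x i = 0) ->
  has_sum x (\sum_(i <- F) x i).
Proof.
move=> xF e e0; exists F => G FG; rewrite (big_fset_sub _ FG) [X in _ - (_ + X)]big1_fset.
  by rewrite addr0 subrr rnorm0 ltW.
by move=> i; rewrite in_fsetD => /andP[/xF].
Qed.

Lemma has_sum1 V (x : I -> V) i0 : (forall i, i != i0 -> x i = 0) -> has_sum x (x i0).
Proof.
move=> xi; have := @has_sum_finite V x [fset i0]%fset; rewrite big_seq_fset1; apply.
by move=> i; rewrite inE => /xi.
Qed.

Lemma sum_le_finite u F : (forall i, 0 <= u i) -> (forall i, i \notin F -> u i = 0) ->
  sum_le u (\sum_(i <- F) u i).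
Proof.
move=> u0 uF G; rewrite (le_trans (ler_sum_fset u0 (fsubsetUl G F))) //.
rewrite (big_fset_sub _ (fsubsetUr G F)) [X in _ + X]big1_fset ?addr0 //.
by move=> i; rewrite in_fsetD => /andP[/uF].
Qed.

Lemma has_sum_le V (x : I -> V) s M : sum_le (fun i => rnorm (x i)) M ->
  has_sum x s -> rnorm s <= M.
Proof.
move=> xM xs; apply/ler_addgt0Pr => e /xs [F /(_ F (fsubset_refl _)) hF].
have := rnormD (s - \sum_(i <- F) x i) (\sum_(i <- F) x i); rewrite subrK.
have := le_trans (rnorm_sum F xpredT x) (xM F); lra.
Qed.

(** The tail of an absolutely summable family controls the error made by its
    finite partial sums. *)
Lemma has_sum_tail V (x : I -> V) s F e :
  (forall G, [disjoint F & G]%fset -> \sum_(i <- G) rnorm (x i) <= e) ->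
  has_sum x s -> rnorm (s - \sum_(i <- F) x i) <= e.
Proof.
move=> tl xs; apply/ler_addgt0Pr => e' /xs[G hG].
have := hG _ (fsubsetUr F G); rewrite (big_fset_sub _ (fsubsetUl F G)) opprD addrA.
set S := \sum_(i <- (_ `\` _)%fset) _ => h.
have : rnorm S <= e.
  by rewrite (le_trans (rnorm_sum _ _ _)) // tl // fdisjointXD.
have := rnormD (s - \sum_(i <- F) x i - S) S; rewrite subrK; lra.
Qed.

Lemma has_sum_sum V (K : Type) (r : seq K) (x : K -> I -> V) (s : K -> V) :
  (forall k, has_sum (x k) (s k)) ->
  has_sum (fun i => \sum_(k <- r) x k i) (\sum_(k <- r) s k).
Proof.
move=> xs; elim: r => [|k r IH].
  by move=> e e0; exists fset0 => G _; rewrite big_nil big1 ?subr0 ?rnorm0 ?ltW // => i _; rewrite big_nil.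
rewrite big_cons (_ : (fun _ => _) = fun i => x k i + \sum_(k' <- r) x k' i).
  exact: has_sumD.
by apply/funext => i; rewrite big_cons.
Qed.

End finite_sums.

Section reindexing.
Variables (R : realType) (I J : choiceType) (f : J -> I).

Lemma sum_le_inj (u : I -> R) M : injective f -> sum_le u M -> sum_le (u \o f) M.
Proof.
move=> finj uM F; have := uM (f @` F)%fset; rewrite big_imfset //=.
by move=> ? ? _ _ /finj.
Qed.

Lemma has_sum_bij (V : normedZmodType R[i]) (g : I -> J) (x : I -> V) s :
  cancel f g -> cancel g f -> has_sum x s -> has_sum (x \o f) s.
Proof.
move=> fg gf xs e /xs[F hF]; exists (g @` F)%fset => G FG.
have := hF (f @` G)%fset; rewrite big_imfset /=; last by move=> ? ? _ _ /(can_inj fg).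
apply; apply/fsubsetP => i iF; apply/imfsetP; exists (g i); rewrite ?gf //=.
by apply: (fsubsetP FG); rewrite in_imfset.
Qed.

End reindexing.

Section fubini.
Variables (R : realType) (I J : choiceType) (V : normedZmodType R[i]).

Lemma big_fsetM (W : nmodType) (u : I * J -> W) (F : {fset I}) (G : {fset J}) :
  \sum_(p <- (F `*` G)%fset) u p = \sum_(i <- F) \sum_(j <- G) u (i, j).
Proof. by rewrite big_imfset2 //= => -[a b] [c e] /= _ _ [-> ->]. Qed.

Variables (x : I * J -> V) (s : I -> V).
Hypothesis xs : forall i, has_sum (fun j => x (i, j)) (s i).

(** The iterated sum of an absolutely summable double family is its total
    sum: a finite set carrying all but e of the total mass may be enlarged to
    a rectangle, whose rows are then summed up to a total error e. *)
Lemma has_sum_fubini S M : sum_le (fun p => rnorm (x p)) M -> has_sum x S ->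
  has_sum s S.
Proof.
move=> xM xS e e0; have e20 : 0 < e / 2 by rewrite divr_gt0.
have [F hF] := sum_le_tail (fun p => rnorm_ge0 (x p)) xM e20.
pose F1 := (fst @` F)%fset; pose F2 := (snd @` F)%fset.
have FM G H : (F1 `<=` G)%fset -> (F2 `<=` H)%fset -> (F `<=` G `*` H)%fset.
  move=> G1 H2; apply/fsubsetP => p pF; rewrite in_fsetM.
  by rewrite (fsubsetP G1) ?(fsubsetP H2) // in_imfset.
exists F1 => G F1G; pose B := (G `*` F2)%fset.
have h1 : rnorm (S - \sum_(p <- B) x p) <= e / 2.
  apply: (has_sum_tail _ xS) => H BH; apply: hF; apply: fdisjointWl BH.
  exact: FM.
have h2 : rnorm (\sum_(i <- G) s i - \sum_(p <- B) x p) <= e / 2.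
  rewrite big_fsetM exchange_big /=.
  have hs := has_sum_sum G (x := fun i j => x (i, j)) xs.
  apply: (has_sum_tail _ hs) => H H2.
  apply: (@le_trans _ _ (\sum_(p <- (G `*` H)%fset) rnorm (x p))).
    by rewrite big_fsetM exchange_big /= ler_sum // => j _; exact: rnorm_sum.
  apply: hF; apply/fdisjointP => p pF; rewrite in_fsetM negb_and.
  by rewrite ((fdisjointP H2) p.2) ?orbT // in_imfset.
move: h1 h2 (rdist_tri S (\sum_(p <- B) x p) (\sum_(i <- G) s i)).
rewrite [rnorm (\sum_(p <- B) _ - _)]rdistC; rnlra.
Qed.

(** Finitely many row sums are all approximated by partial sums over one
    common finite set of columns. *)
Lemma sum_le_fubini M : sum_le (fun p => rnorm (x p)) M ->
  sum_le (fun i => rnorm (s i)) M.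
Proof.
move=> xM G; apply/ler_addgt0Pr => e e0.
have [H hH] : exists H : {fset J}, forall H', (H `<=` H')%fset ->
   \sum_(i <- G) rnorm (s i) <= \sum_(i <- G) \sum_(j <- H') rnorm (x (i, j)) + e.
  elim: (enum_fset G) e e0 => [|i r IH] e e0.
    by exists fset0 => H' _; rewrite !big_nil add0r ltW.
  have e20 : 0 < e / 2 by rewrite divr_gt0.
  have [H1 h1] := IH _ e20; have [H2 h2] := xs i e20.
  exists (H1 `|` H2)%fset => H'; rewrite fsubUset => /andP[/h1 k1 /h2 k2].
  rewrite !big_cons; have := rnormD (s i - \sum_(j <- H') x (i, j)) (\sum_(j <- H') x (i, j)).
  rewrite subrK; have := rnorm_sum H' xpredT (fun j => x (i, j)); move: k1 k2; rnlra.
rewrite (le_trans (hH H (fsubset_refl _))) // lerD2r -(big_fsetM (fun p => rnorm (x p))).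
exact: xM.
Qed.

End fubini.

Section infinite_sums.
Variable R : realType.

Lemma eq_has_sum (V : normedZmodType R[i]) (I : choiceType) (x y : I -> V) s :
  x =1 y -> has_sum x s -> has_sum y s.
Proof. by move=> /funext ->. Qed.

Lemma has_sumMl (J : choiceType) (c : R[i]) (x : J -> R[i]) s :
  has_sum x s -> has_sum (fun j => c * x j) (c * s).
Proof.
apply: (has_sum_map (C := rnorm c)) => [u v|v]; first exact: mulrDr.
by rewrite rnormM.
Qed.

Lemma has_sum_conj (J : choiceType) (x : J -> R[i]) s :
  has_sum x s -> has_sum (fun j => (x j)^*) (s^*).
Proof.
apply: (has_sum_map (C := 1)) => [u v|v]; first exact: rmorphD.
by rewrite rnormJ mul1r.
Qed.

Lemma has_sumZ (V : normedModType R[i]) (I : choiceType) (l : R[i]) (x : I -> V) s :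
  has_sum x s -> has_sum (fun i => l *: x i) (l *: s).
Proof.
apply: (has_sum_map (C := rnorm l)) => [u v|v]; first exact: scalerDr.
by rewrite rnormZ.
Qed.

Lemma has_sumZl (V : normedModType R[i]) (I : choiceType) (v : V) (x : I -> R[i]) s :
  has_sum x s -> has_sum (fun i => x i *: v) (s *: v).
Proof.
apply: (has_sum_map (f := fun w : R[i] => w *: v) (C := rnorm v)) => [u w|w].
  exact: scalerDl.
by rewrite rnormZ mulrC.
Qed.

Lemma sum_le_prod (I J : choiceType) (u : I -> R) (v : J -> R) M N :
  (forall i, 0 <= u i) -> (forall j, 0 <= v j) -> sum_le u M -> sum_le v N ->
  sum_le (fun p : I * J => u p.1 * v p.2) (M * N).
Proof.
move=> u0 v0 uM vN F; pose F1 := (fst @` F)%fset; pose F2 := (snd @` F)%fset.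
have FF : (F `<=` F1 `*` F2)%fset.
  by apply/fsubsetP => p pF; rewrite in_fsetM !in_imfset.
apply: (le_trans (ler_sum_fset _ FF)) => [p|]; first exact: mulr_ge0.
rewrite big_fsetM /=; under eq_bigr do rewrite -mulr_sumr.
rewrite -mulr_suml ler_pM ?sumr_ge0 //.
Qed.

Lemma sum_le_triangle (I J : choiceType) (u : I * J -> R) (v : I -> R) M :
  (forall p, 0 <= u p) -> (forall i, sum_le (fun j => u (i, j)) (v i)) -> sum_le v M ->
  sum_le u M.
Proof.
move=> u0 uv vM F; pose F1 := (fst @` F)%fset; pose F2 := (snd @` F)%fset.
have FF : (F `<=` F1 `*` F2)%fset.
  by apply/fsubsetP => p pF; rewrite in_fsetM !in_imfset.
apply: (le_trans (ler_sum_fset u0 FF)); rewrite big_fsetM (le_trans _ (vM F1)) //.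
by apply: ler_sum => i _; exact: uv.
Qed.

Lemma sum_le_row (I J : choiceType) (u : I * J -> R) M i :
  sum_le u M -> sum_le (fun j => u (i, j)) M.
Proof. by apply: (@sum_le_inj _ _ _ (fun j => (i, j)) u M) => j j' []. Qed.

Lemma sum_le_swap (I J : choiceType) (u : I * J -> R) M :
  sum_le u M -> sum_le (fun p : J * I => u (p.2, p.1)) M.
Proof. by apply: (@sum_le_inj _ _ _ (fun p : J * I => (p.2, p.1))) => -[? ?] [? ?] [-> ->]. Qed.

Lemma has_sum_swap (V : normedZmodType R[i]) (I J : choiceType) (x : I * J -> V) s :
  has_sum x s -> has_sum (fun p : J * I => x (p.2, p.1)) s.
Proof.
by apply: (@has_sum_bij _ _ _ (fun p : J * I => (p.2, p.1)) _ (fun p : I * J => (p.2, p.1))) => -[].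
Qed.

Lemma esum_lty (I : choiceType) (u : I -> R) : (forall i, 0 <= u i) ->
  (\esum_(i in [set: I]) (u i)%:E < +oo)%E <-> exists M, sum_le u M.
Proof.
move=> u0; have le (F : {fset I}) : ((\sum_(i <- F) u i)%:E <= \esum_(i in [set: I]) (u i)%:E)%E.
  apply: ereal_sup_ubound; exists [set` F].
    by split=> //; exact: finite_fset.
  by rewrite (fsbig_finite _ _ (finite_fset _)) /= set_fsetK sumEFin.
split=> [fin|[M uM]].
  exists (fine (\esum_(i in [set: I]) (u i)%:E)) => F.
  rewrite -lee_fin fineK // ge0_fin_numE //.
  by apply: esum_ge0 => i _; rewrite lee_fin.
apply: (@le_lt_trans _ _ M%:E); last exact: ltry.
apply: ge_ereal_sup => _ [F [finF _] <-].
by rewrite fsbig_finite //= sumEFin lee_fin.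
Qed.

Lemma esum_has_sum (I : choiceType) (u : I -> R) M : (forall i, 0 <= u i) ->
  sum_le u M -> forall e, 0 < e -> exists F : {fset I}, forall G,
    (F `<=` G)%fset ->
  `|fine (\esum_(i in [set: I]) (u i)%:E) - \sum_(i <- G) u i| <= e.
Proof.
move=> u0 uM e e0.
have fin : (\esum_(i in [set: I]) (u i)%:E < +oo)%E by apply/esum_lty => //; exists M.
have nn : (0 <= \esum_(i in [set: I]) (u i)%:E)%E by apply: esum_ge0 => i _; rewrite lee_fin.
have ft : (\esum_(i in [set: I]) (u i)%:E)%E \is a fin_num by rewrite ge0_fin_numE.
have [_ [F [finF _] <-]] := ub_ereal_sup_adherent e0 ft.
rewrite fsbig_finite //= sumEFin -/(esum _ _) => hF.
exists (fset_set F) => G FG.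
have le : ((\sum_(i <- G) u i)%:E <= \esum_(i in [set: I]) (u i)%:E)%E.
  apply: ereal_sup_ubound; exists [set` G].
    by split=> //; exact: finite_fset.
  by rewrite (fsbig_finite _ _ (finite_fset _)) /= set_fsetK sumEFin.
have := ler_sum_fset u0 FG; move: hF le.
rewrite -(fineK ft) -EFinB lte_fin lee_fin => h1 h2 h3.
rewrite ler_norml; apply/andP; split; lra.
Qed.

Lemma rsum_has_sum (I : choiceType) (f : I -> R) M :
  sum_le (fun i => `|f i|) M -> forall e, 0 < e -> exists F : {fset I}, forall G,
    (F `<=` G)%fset -> `|rsum f - \sum_(i <- G) f i| <= e.
Proof.
move=> fM e e0; have e20 : 0 < e / 2 by rewrite divr_gt0.
have hp : sum_le (fun i => Num.max (f i) 0) M.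
  by apply: sum_le_mono fM => i; rewrite ge_max ler_norm normr_ge0.
have hn : sum_le (fun i => Num.max (- f i) 0) M.
  by apply: sum_le_mono fM => i; rewrite ge_max -{1}normrN ler_norm normr_ge0.
have max0 (v : R) : 0 <= Num.max v 0 by rewrite le_max lexx orbT.
have [F hF] := esum_has_sum (fun i => max0 (f i)) hp e20.
have [G hG] := esum_has_sum (fun i => max0 (- f i)) hn e20.
exists (F `|` G)%fset => H; rewrite fsubUset => /andP[/hF h1 /hG h2].
rewrite /rsum.
have -> : (fun i => ((EFin \o f)^\+ i)%E) = (fun i => (Num.max (f i) 0)%:E).
  by apply/funext => i; rewrite funeposE /= EFin_max.
have -> : (fun i => ((EFin \o f)^\- i)%E) = (fun i => (Num.max (- f i) 0)%:E).
  by apply/funext => i; rewrite funenegE /= EFin_max.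
have -> : \sum_(i <- H) f i = \sum_(i <- H) Num.max (f i) 0 - \sum_(i <- H) Num.max (- f i) 0.
  rewrite -sumrB; apply: eq_bigr => i _; case: (leP 0 (f i)) => h.
    by rewrite max_r ?subr0 // oppr_le0.
  by rewrite max_l ?oppr_ge0 ?(ltW h)// sub0r opprK.
move: h1 h2; set A := fine _; set B := fine _; rewrite !ler_norml => /andP[? ?] /andP[? ?].
apply/andP; split; lra.
Qed.

Lemma csum_has_sum (I : choiceType) (f : I -> R[i]) M :
  sum_le (fun i => rnorm (f i)) M -> has_sum f (csum f).
Proof.
move=> fM e e0; have e20 : 0 < e / 2 by rewrite divr_gt0.
have [F hF] := rsum_has_sum (sum_le_mono (fun i => le_Re_rnorm (f i)) fM) e20.
have [G hG] := rsum_has_sum (sum_le_mono (fun i => le_Im_rnorm (f i)) fM) e20.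
exists (F `|` G)%fset => H; rewrite fsubUset => /andP[/hF h1 /hG h2].
apply: (le_trans (rnorm_ReIm _)); rewrite (splitr e) lerD //.
  by rewrite raddfB raddf_sum.
by rewrite raddfB raddf_sum.
Qed.

(** Absolutely summable families are summable in complete spaces: the partial
    sums are Cauchy along the directed set of finite index sets. *)
Lemma has_sum_complete (I : choiceType) (V : completeNormedModType R[i]) (x : I -> V) M :
  sum_le (fun i => rnorm (x i)) M -> exists s, has_sum x s.
Proof.
move=> xM; pose T : set_system V := filter_from [set: {fset I}]
  (fun F => [set s | exists2 G, (F `<=` G)%fset & s = \sum_(i <- G) x i]).
have TF : ProperFilter T.
  apply: filter_from_proper; first apply: filter_from_filter.
  - by exists fset0.
  - move=> F G _ _; exists (F `|` G)%fset => // s [H FGH ->].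
    by split; exists H => //; rewrite (fsubset_trans _ FGH) ?fsubsetUl ?fsubsetUr.
  - by move=> F _; exists (\sum_(i <- F) x i); exists F.
have : cauchy T.
  apply: cauchy_exP => e; rewrite ltcE /= => /andP[/eqP im e0].
  have e20 : 0 < complex.Re e / 2 by rewrite divr_gt0.
  have [F hF] := sum_le_tail (fun i => rnorm_ge0 (x i)) xM e20.
  exists (\sum_(i <- F) x i); exists F => // s [G FG ->].
  rewrite -ball_normE /= (_ : e = real_complex R (complex.Re e)); last first.
    by case: e im {e0 e20 hF} => a b /= ->.
  rewrite lt_norm_rnorm (big_fset_sub _ FG) opprD addNKr rnormN.
  rewrite (le_lt_trans (rnorm_sum _ _ _)) // (le_lt_trans (hF _ _)) ?fdisjointXD //.
  lra.
move/cauchy_cvg => /cvg_ex[s Ts]; exists s => e e0.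
have Ts' : @id V x @[x --> T] --> s by [].
have /cvgrPdist_le/(_ (real_complex R e))[|F _ hF] := Ts'; first by rewrite ltcR.
by exists F => G FG; rewrite -le_norm_rnorm; apply: hF; exists G.
Qed.

End infinite_sums.

(** * Inner products and the Hilbert space of square summable families *)
Section inner_product.
Variables (R : realType) (H : normedModType R[i]) (ip : H -> H -> R[i]).
Hypothesis ipP : is_inner_product ip.

Lemma ipDl x y z : ip (x + y) z = ip x z + ip y z.
Proof. by case: ipP => lin _ _; rewrite -[x in LHS]scale1r lin mul1r. Qed.

Lemma ip0l z : ip 0 z = 0.
Proof. by apply: (addrI (ip 0 z)); rewrite -ipDl !addr0. Qed.

Lemma ipZl l x z : ip (l *: x) z = l * ip x z.
Proof. by case: ipP => lin _ _; rewrite -[l *: x]addr0 lin ip0l addr0. Qed.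

Lemma ipC x y : ip y x = (ip x y)^*.
Proof. by case: ipP. Qed.

Lemma ipDr x y z : ip z (x + y) = ip z x + ip z y.
Proof. by rewrite ipC ipDl rmorphD /= -!ipC. Qed.

Lemma ipZr l x z : ip z (l *: x) = l^* * ip z x.
Proof. by rewrite ipC ipZl rmorphM /= -ipC. Qed.

Lemma ipxx x : ip x x = real_complex R (rnorm x ^+ 2).
Proof. by case: ipP => _ _ ->; rewrite rmorphXn /= rnormE. Qed.

(** The square norm of [N x - c y], where [N] is the square norm of [y] and
    [c = ip x y], equals [N (N ||x||^2 - |c|^2)]. *)
Lemma cauchy_schwarz x y : rnorm (ip x y) <= rnorm x * rnorm y.
Proof.
pose N := real_complex R (rnorm y ^+ 2); pose c := ip x y.
have := sqr_ge0 (rnorm (N *: x + (- c) *: y)).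
rewrite -ler0c -ipxx ipDl !ipDr !ipZl !ipZr !ipxx (ipC x y) -/N -/c.
rewrite rmorphN /= conj_real.
set X := real_complex R (rnorm x ^+ 2); set c' := c^*.
have -> : N * (N * X) + N * (- c' * c) + (- c * (N * c') + - c * (- c' * N)) =
  N * (N * X - c * c') by ring.
rewrite /c' mul_conj_rnorm /N /X -rmorphM -rmorphB -rmorphM /= ler0c => h.
have [y0|y0] := eqVneq (rnorm y) 0.
  have y0' : y = 0 by exact: rnorm0_eq0.
  by rewrite /c y0' ipC ip0l rnormJ rnorm0 mulr_ge0 ?rnorm_ge0.
have y2 : 0 < rnorm y ^+ 2 by rewrite exprn_even_gt0.
move: h; rewrite pmulr_rge0 // subr_ge0 -exprMn mulrC.
by rewrite ler_pXn2r ?nnegrE ?mulr_ge0 ?rnorm_ge0.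
Qed.

End inner_product.

Section l2_space.
Variables (R : realType) (I : choiceType) (H : completeNormedModType R[i]).

Definition square_summable : {pred I -> H} :=
  [pred f : I -> H | `[< exists M, sum_le (fun i => rnorm (f i) ^+ 2) M >]].

Lemma square_summable_submod : submod_closed square_summable.
Proof.
split; first by apply/asboolP; exists 0 => F; rewrite big1 // => i _; rewrite rnorm0 expr0n.
move=> l f g /asboolP[M fM] /asboolP[N gN]; apply/asboolP.
exists ((2 * rnorm l ^+ 2) * M + 2 * N).
have c0 : 0 <= 2 * rnorm l ^+ 2 by rewrite mulr_ge0 ?sqr_ge0.
apply: sum_le_mono (sum_leD (sum_leZ c0 fM) (sum_leZ (ler0n R 2) gN)) => i.
have h : rnorm (l *: f i + g i) <= rnorm l * rnorm (f i) + rnorm (g i).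
  by rewrite -rnormZ rnormD.
have := rnorm_ge0 (l *: f i + g i); move: h; rewrite -[(l *: f + g) i]/(l *: f i + g i).
set a := rnorm (_ + _); set b := rnorm l; set c := rnorm (f i); set e := rnorm (g i).
move=> h a0; apply: (@le_trans _ _ ((b * c + e) ^+ 2)); first by rewrite lerXn2r ?nnegrE ?(le_trans a0 h).
by have := sqr_ge0 (b * c - e); nra.
Qed.

Record l2 := L2 { l2val :> I -> H ; _ : l2val \in square_summable }.

HB.instance Definition _ := [isSub for l2val].
HB.instance Definition _ := gen_eqMixin l2.
HB.instance Definition _ := gen_choiceMixin l2.
HB.instance Definition _ := GRing.SubChoice_isSubLmodule.Build R[i] (I -> H)
  square_summable l2 square_summable_submod.

Implicit Types (f g : l2) (l : R[i]).

Lemma l2_eqP (f g : l2) : (forall i, f i = g i) -> f = g.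
Proof. by move=> fg; apply: val_inj; apply/funext. Qed.

Lemma l2E_add (f g : l2) i : (f + g) i = f i + g i. Proof. by []. Qed.

Lemma l2E_scale (l : R[i]) (f : l2) i : (l *: f) i = l *: f i. Proof. by []. Qed.

Lemma l2E_opp (f : l2) i : (- f) i = - f i. Proof. by []. Qed.

Definition l2norm (f : l2) : R :=
  Num.sqrt (sup (range (fun F : {fset I} => \sum_(i <- F) rnorm (f i) ^+ 2))).

Lemma l2norm_ge0 f : 0 <= l2norm f. Proof. exact: sqrtr_ge0. Qed.

Lemma sum_le_l2norm f : sum_le (fun i => rnorm (f i) ^+ 2) (l2norm f ^+ 2).
Proof.
have /asboolP[M fM] := valP f => F.
set S := range (fun F : {fset I} => \sum_(i <- F) rnorm (f i) ^+ 2).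
have Sub : has_ubound S by exists M => _ [G _ <-].
have le : \sum_(i <- F) rnorm (f i) ^+ 2 <= sup S by apply: ub_le_sup => //; exists F.
by rewrite sqr_sqrtr // (le_trans _ le) // sumr_ge0 // => i _; rewrite sqr_ge0.
Qed.

Lemma l2norm_le f C : 0 <= C ->
  sum_le (fun i => rnorm (f i) ^+ 2) (C ^+ 2) -> l2norm f <= C.
Proof.
move=> C0 fC; rewrite -(ger0_norm C0) -sqrtr_sqr ler_wsqrtr //.
apply: ge_sup; first by exists (\sum_(i <- fset0) rnorm (f i) ^+ 2); exists fset0.
by move=> _ [F _ <-].
Qed.

Lemma l2norm_coord f i : rnorm (f i) <= l2norm f.
Proof.
rewrite -(@ler_pXn2r _ 2) ?nnegrE ?l2norm_ge0 ?rnorm_ge0 //.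
exact: (sum_le1 i (@sum_le_l2norm f)).
Qed.

Lemma l2norm_eq0 f : l2norm f = 0 -> f = 0.
Proof.
move=> f0; apply: l2_eqP => i; apply: rnorm0_eq0; apply/eqP.
by rewrite eq_le rnorm_ge0 andbT -f0 l2norm_coord.
Qed.

(** With [A] and [B] the norms of [f] and [g], the inequality
    [(u + v)^2 <= (1 + B / A) u^2 + (1 + A / B) v^2] is summed term by term: the
    right-hand sides add up to at most [(A + B)^2]. *)
Lemma l2normD f g : l2norm (f + g) <= l2norm f + l2norm g.
Proof.
have [f0|f0] := eqVneq (l2norm f) 0; first by rewrite (l2norm_eq0 f0) add0r lerDr l2norm_ge0.
have [g0|g0] := eqVneq (l2norm g) 0; first by rewrite (l2norm_eq0 g0) addr0 lerDl l2norm_ge0.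
have A0 : 0 < l2norm f by rewrite lt_def f0 l2norm_ge0.
have B0 : 0 < l2norm g by rewrite lt_def g0 l2norm_ge0.
apply: l2norm_le; first by rewrite addr_ge0 ?l2norm_ge0.
have := @sum_le_l2norm f; have := @sum_le_l2norm g.
move: A0 B0; set A := l2norm f; set B := l2norm g => A0 B0 gB fA.
have c1 : 0 <= 1 + B / A by rewrite addr_ge0 ?divr_ge0 ?ltW.
have c2 : 0 <= 1 + A / B by rewrite addr_ge0 ?divr_ge0 ?ltW.
have -> : (A + B) ^+ 2 = (1 + B / A) * A ^+ 2 + (1 + A / B) * B ^+ 2.
  by field; rewrite ?(gt_eqF A0) ?(gt_eqF B0).
apply: sum_le_mono (sum_leD (sum_leZ c1 fA) (sum_leZ c2 gB)) => i.
rewrite l2E_add; have := rnormD (f i) (g i); have := rnorm_ge0 (f i + g i).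
set u := rnorm (f i); set v := rnorm (g i); set w := rnorm _ => w0 wuv.
apply: (@le_trans _ _ ((u + v) ^+ 2)); first by rewrite lerXn2r ?nnegrE ?(le_trans w0).
rewrite -subr_ge0.
have -> : (1 + B / A) * u ^+ 2 + (1 + A / B) * v ^+ 2 - (u + v) ^+ 2 =
   (A * B) * (u / A - v / B) ^+ 2.
  by field; rewrite ?(gt_eqF A0) ?(gt_eqF B0).
by rewrite mulr_ge0 ?sqr_ge0 // mulr_ge0 ?ltW.
Qed.

Lemma l2normZ_le l f : l2norm (l *: f) <= rnorm l * l2norm f.
Proof.
apply: l2norm_le; first by rewrite mulr_ge0 ?rnorm_ge0 ?l2norm_ge0.
rewrite exprMn; apply: sum_le_mono (sum_leZ (sqr_ge0 (rnorm l)) (@sum_le_l2norm f)) => i.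
by rewrite l2E_scale rnormZ exprMn.
Qed.

Lemma l2normZ l f : l2norm (l *: f) = rnorm l * l2norm f.
Proof.
apply/eqP; rewrite eq_le l2normZ_le /=.
have [->|l0] := eqVneq l 0; first by rewrite rnorm0 mul0r l2norm_ge0.
have r0 : 0 < rnorm l by rewrite lt_def rnorm_ge0 andbT; apply: contra_neq l0 => /rnorm0_eq0.
rewrite -ler_pdivlMl //; have := l2normZ_le l^-1 (l *: f).
rewrite scalerA mulVf // scale1r; suff -> : rnorm l^-1 = (rnorm l)^-1 by [].
by apply: complexI; rewrite fmorphV /= !rnormE normfV.
Qed.

Let l2C f : R[i] := real_complex R (l2norm f).

Let l2CD f g : l2C (f + g) <= l2C f + l2C g.
Proof. by rewrite /l2C -rmorphD lecR l2normD. Qed.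

Let l2CZ l f : l2C (l *: f) = `|l| * l2C f.
Proof. by rewrite /l2C l2normZ rmorphM /= rnormE. Qed.

Let l2C_eq0 f : l2C f = 0 -> f = 0.
Proof. by case=> /l2norm_eq0. Qed.

HB.instance Definition _ := Lmodule_isNormed.Build R[i] l2 l2CD l2CZ l2C_eq0.

Lemma rnorm_l2 (f : l2) : rnorm f = l2norm f. Proof. by []. Qed.

Lemma rnorm_l2_coord (f : l2) i : rnorm (f i) <= rnorm f.
Proof. exact: l2norm_coord. Qed.

(** A Cauchy filter converges coordinatewise, and a bound on the finite partial
    sums of a square distance passes to this limit. *)
Lemma l2_complete (F : set_system l2) : ProperFilter F -> cauchy F -> cvg F.
Proof.
move=> FF; move/cauchyP => Fc.
have Fb (e : R) : 0 < e -> exists f0 : l2, F [set f | rnorm (f0 - f) < e].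
  move=> e0; have [|f0 Ff0] := Fc (real_complex R e); first by rewrite ltcR.
  by exists f0; apply: filterS Ff0 => f /ball_rnorm.
have /choice[g hg] : forall i, exists y : H, (fun f : l2 => f i) f @[f --> F] --> y.
  move=> i; apply/cvg_ex; apply: cauchy_cvg; apply: cauchy_exP => _ /gt0_realP[e e0 ->].
  have [f0 Ff0] := Fb _ e0; exists (f0 i).
  change (F [set f : l2 | ball (f0 i) (real_complex R e) (f i)]); apply: filterS Ff0 => f /= h.
  by apply/ball_rnorm; apply: le_lt_trans h; by have := rnorm_l2_coord (f0 - f) i; rewrite l2E_add l2E_opp.
have key (e : R) (f0 : l2) : 0 < e -> F [set f | rnorm (f0 - f) < e] ->
    sum_le (fun i => rnorm (f0 i - g i) ^+ 2) (e ^+ 2).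
  move=> e0 Ff0 G; apply: (@closed_cvg _ _ F FF (fun f : l2 => \sum_(i <- G) rnorm (f0 i - f i) ^+ 2)
    (fun x : R => x <= e ^+ 2)).
  - exact: (@closed_le R (e ^+ 2)).
  - apply: filterS Ff0 => f /= h.
    apply: le_trans (@sum_le_l2norm (f0 - f) G) _.
    by rewrite lerXn2r ?nnegrE ?l2norm_ge0 ?ltW.
  - apply: cvg_big; first exact: add_continuous.
    move=> i _; apply: cvgM; apply: cvg_rnorm; apply: cvgB; try exact: cvg_cst; exact: hg.
have gP : g \in square_summable.
  have [f0 Ff0] := Fb 1 ltr01.
  have h : (l2val f0 - g) \in square_summable.
    by apply/asboolP; exists (1 ^+ 2); exact: key.
  have -> : g = (-1) *: (l2val f0 - g) + l2val f0 by rewrite scaleN1r opprB subrK.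
  by have [_] := square_summable_submod; apply => //; exact: (valP f0).
pose gl := L2 gP; apply/cvg_ex; exists gl.
apply: (iffRL (@cvg_rnormP R l2 l2 F id gl _)) => e e0.
have e20 : 0 < e / 2 by rewrite divr_gt0.
have [f0 Ff0] := Fb _ e20.
have h0 : rnorm (f0 - gl) <= e / 2.
  by rewrite rnorm_l2; apply: l2norm_le; [exact: ltW|exact: key].
apply: filterS Ff0 => f /=; move: h0 (rdist_tri gl f0 f).
rewrite [rnorm (gl - f0)]rdistC; rnlra.
Qed.

HB.instance Definition _ := Uniform_isComplete.Build l2 l2_complete.

End l2_space.

Section l2_inner_product.
Variables (R : realType) (I : choiceType) (H : completeNormedModType R[i]).
Variable ip : H -> H -> R[i].
Hypothesis ipP : is_inner_product ip.

Definition l2ip (f g : l2 I H) : R[i] := csum (fun i => ip (f i) (g i)).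

Lemma l2ip_summable (f g : l2 I H) :
  sum_le (fun i => rnorm (ip (f i) (g i))) (l2norm f ^+ 2 + l2norm g ^+ 2).
Proof.
apply: sum_le_mono (sum_leD (@sum_le_l2norm _ _ _ f) (@sum_le_l2norm _ _ _ g)) => i.
apply: (le_trans (cauchy_schwarz ipP _ _)).
have := rnorm_ge0 (f i); have := rnorm_ge0 (g i).
by set a := rnorm _; set b := rnorm _; have := sqr_ge0 (a - b); nra.
Qed.

Lemma l2ip_has_sum (f g : l2 I H) : has_sum (fun i => ip (f i) (g i)) (l2ip f g).
Proof. exact: csum_has_sum (@l2ip_summable f g). Qed.

Lemma l2ip_inner : is_inner_product l2ip.
Proof.
split=> [l x y z|x y|x].
- apply: (has_sum_unique (l2ip_has_sum _ _)).
  have := has_sumD (has_sumMl l (l2ip_has_sum x z)) (l2ip_has_sum y z).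
  congr has_sum; apply/funext => i.
  by rewrite l2E_add l2E_scale (ipDl ipP) (ipZl ipP).
- apply: (has_sum_unique (l2ip_has_sum _ _)).
  rewrite (_ : (fun i => _) = (fun i => (ip (x i) (y i))^* )); last first.
    by apply/funext => i; rewrite (ipC ipP).
  exact: has_sum_conj (l2ip_has_sum x y).
- apply: (has_sum_unique (l2ip_has_sum _ _)).
  rewrite -rnormE -rmorphXn /= => e e0.
  pose S := range (fun F : {fset I} => \sum_(i <- F) rnorm (x i) ^+ 2).
  have S0 : S !=set0 by exists (\sum_(i <- fset0) rnorm (x i) ^+ 2); exists fset0.
  have Sub : has_ubound S by exists (l2norm x ^+ 2) => _ [G _ <-]; exact: sum_le_l2norm.
  have E : rnorm x ^+ 2 = sup S.
    rewrite rnorm_l2 sqr_sqrtr //; apply: (ub_le_sup Sub); exists fset0 => //.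
    by rewrite big_seq_fset0.
  have [_ [F _ <-] hF] := sup_adherent e0 (conj S0 Sub).
  exists F => G FG.
  have -> : \sum_(i <- G) ip (x i) (x i) = real_complex R (\sum_(i <- G) rnorm (x i) ^+ 2).
    by rewrite rmorph_sum /=; apply: eq_bigr => i _; rewrite (ipxx ipP).
  rewrite -rmorphB /= rnorm_real E.
  have h1 : \sum_(i <- G) rnorm (x i) ^+ 2 <= sup S by apply: ub_le_sup => //; exists G.
  have h2 := ler_sum_fset (fun i => sqr_ge0 (rnorm (x i))) FG.
  move: hF h1 h2; rewrite ler_norml; set s := sup _; set a := \sum_(i <- F) _ ; set b := \sum_(i <- G) _.
  by move=> *; apply/andP; split; lra.
Qed.

End l2_inner_product.

(** * The twisted convolution algebra *)
Section cocycle.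
Variable R : realType.

Lemma cexp2piD (s t : R) : cexp2pi (s + t) = cexp2pi s * cexp2pi t.
Proof.
rewrite /cexp2pi mulrDr cosD sinD; apply/eqP; rewrite eq_complex /=.
by rewrite eqxx /= addrC [_ * sin _]mulrC [sin (2 * pi * s) * _]mulrC [X in _ + X]mulrC eqxx.
Qed.

Lemma cexp2pi0 : cexp2pi (0 : R) = 1.
Proof. by rewrite /cexp2pi mulr0 cos0 sin0. Qed.

Lemma rnorm_cexp2pi (t : R) : rnorm (cexp2pi t) = 1.
Proof. by rewrite /rnorm normc_def /= cos2Dsin2 sqrtr1. Qed.

Variable d : nat.
Implicit Types (L : 'M[R]_(d + d)) (k m n : lattice d).

Lemma lattice_cocycleDl L k k' m :
  lattice_cocycle L (k + k') m = lattice_cocycle L k m * lattice_cocycle L k' m.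
Proof.
rewrite /lattice_cocycle /cocycle -cexp2piD -opprD -big_split /=.
congr (cexp2pi (- _)); apply: eq_bigr => i _.
by rewrite map_mxD mulmxDr linearD /= mxE mulrDl.
Qed.

Lemma lattice_cocycleDr L k m m' :
  lattice_cocycle L k (m + m') = lattice_cocycle L k m * lattice_cocycle L k m'.
Proof.
rewrite /lattice_cocycle /cocycle -cexp2piD -opprD -big_split /=.
congr (cexp2pi (- _)); apply: eq_bigr => i _.
by rewrite map_mxD mulmxDr linearD /= [X in _ * X = _]mxE mulrDr.
Qed.

Lemma rnorm_lattice_cocycle L k m : rnorm (lattice_cocycle L k m) = 1.
Proof. exact: rnorm_cexp2pi. Qed.

Lemma lattice_cocycle0l L m : lattice_cocycle L 0 m = 1.
Proof.
rewrite /lattice_cocycle /cocycle big1 ?oppr0 ?cexp2pi0 // => i _.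
by rewrite map_mx0 mulmx0 linear0 mxE mul0r.
Qed.

Lemma lattice_cocycle0r L m : lattice_cocycle L m 0 = 1.
Proof.
rewrite /lattice_cocycle /cocycle big1 ?oppr0 ?cexp2pi0 // => i _.
by rewrite map_mx0 mulmx0 linear0 [X in _ * X]mxE mulr0.
Qed.

Lemma mul_conj_lattice_cocycle L k m :
  lattice_cocycle L k m * (lattice_cocycle L k m)^* = 1.
Proof. by rewrite mul_conj_rnorm rnorm_lattice_cocycle expr1n. Qed.

Lemma lattice_cocycleNl L k m : lattice_cocycle L (- k) m = (lattice_cocycle L k m)^*.
Proof.
rewrite -[LHS]mul1r -(mul_conj_lattice_cocycle L k m) mulrAC -lattice_cocycleDl.
by rewrite subrr lattice_cocycle0l mul1r.
Qed.

Lemma lattice_cocycleNr L k m : lattice_cocycle L k (- m) = (lattice_cocycle L k m)^*.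
Proof.
rewrite -[LHS]mul1r -(mul_conj_lattice_cocycle L k m) mulrAC -lattice_cocycleDr.
by rewrite subrr lattice_cocycle0r mul1r.
Qed.

End cocycle.

Section l1.
Variables (R : realType) (d : nat).
Implicit Types (a b : lattice d -> R[i]) (k m n : lattice d) (L : 'M[R]_(d + d)).

Notation c := lattice_cocycle.

Definition l1_le a (M : R) := sum_le (fun k => rnorm (a k)) M.

Lemma l1P a : l1 a <-> exists M, l1_le a M.
Proof. exact: esum_lty (fun k => rnorm_ge0 (a k)). Qed.

Lemma l1_leW a M : l1_le a M -> l1 a.
Proof. by move=> aM; apply/l1P; exists M. Qed.

Lemma l1_le_lin (l : R[i]) a b M N : l1_le a M -> l1_le b N ->
  l1_le (fun k => l * a k + b k) (rnorm l * M + N).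
Proof.
move=> aM bN; apply: sum_le_mono (sum_leD (sum_leZ (rnorm_ge0 l) aM) bN) => k.
by rewrite (le_trans (rnormD _ _)) // rnormM.
Qed.

Lemma l1_zero : l1 ((fun=> 0) : lattice d -> R[i]).
Proof. by apply/l1P; exists 0 => F; rewrite big1 // => i _; rewrite rnorm0. Qed.

Lemma l1_lin (l : R[i]) a b : l1 a -> l1 b -> l1 (fun k => l * a k + b k).
Proof. by move=> /l1P[M aM] /l1P[N bN]; apply: l1_leW (l1_le_lin l aM bN). Qed.

(** Here [p = (n, k)], so that the row of index [n] sums to the convolution at
    [n]. *)
Definition conv_term L a b (p : lattice d * lattice d) : R[i] :=
  a p.2 * b (p.1 - p.2) * c L p.2 (p.1 - p.2).

Lemma sum_le_conv L a b M N : l1_le a M -> l1_le b N ->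
  sum_le (fun p => rnorm (conv_term L a b p)) (M * N).
Proof.
move=> aM bN; pose f (p : lattice d * lattice d) := (p.2, p.1 - p.2).
have finj : injective f by move=> [n k] [n' k'] [-> /addIr ->].
apply: sum_le_mono (sum_le_inj finj (sum_le_prod _ _ aM bN)) => p /=;
  try exact: rnorm_ge0.
by rewrite !rnormM rnorm_lattice_cocycle mulr1.
Qed.

Lemma conv_has_sum L a b n : l1 a -> l1 b ->
  has_sum (fun k => a k * b (n - k) * c L k (n - k)) (twisted_conv L a b n).
Proof.
move=> /l1P[M aM] /l1P[N bN].
exact: csum_has_sum (sum_le_row n (sum_le_conv L aM bN)).
Qed.

Lemma l1_le_conv L a b M N : l1_le a M -> l1_le b N ->
  l1_le (twisted_conv L a b) (M * N).
Proof.
move=> aM bN; apply: sum_le_fubini (sum_le_conv L aM bN) => n.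
by apply: conv_has_sum; apply: l1_leW; eassumption.
Qed.

Lemma l1_conv L a b : l1 a -> l1 b -> l1 (twisted_conv L a b).
Proof. by move=> /l1P[M aM] /l1P[N bN]; apply: l1_leW (l1_le_conv L aM bN). Qed.

Lemma l1_le_star L a M : l1_le a M -> l1_le (twisted_star L a) M.
Proof.
move=> aM; apply: sum_le_mono (sum_le_inj (@oppr_inj _) aM) => k /=.
by rewrite rnormM rnormJ rnorm_lattice_cocycle mulr1.
Qed.

Lemma l1_star L a : l1 a -> l1 (twisted_star L a).
Proof. by move=> /l1P[M aM]; apply: l1_leW (l1_le_star L aM). Qed.

Definition delta k : lattice d -> R[i] := fun n => (n == k)%:R.

Lemma delta_eq0 k n : n != k -> delta k n = 0.
Proof. by rewrite /delta => /negPf ->. Qed.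

Lemma deltaxx k : delta k k = 1.
Proof. by rewrite /delta eqxx. Qed.

Lemma l1_le_delta k : l1_le (delta k) 1.
Proof.
have := @sum_le_finite R _ (fun n => rnorm (delta k n)) [fset k]%fset
  (fun n => rnorm_ge0 _).
rewrite big_seq_fset1 deltaxx rnorm1; apply => n; rewrite inE => /delta_eq0 ->.
exact: rnorm0.
Qed.

Lemma l1_delta k : l1 (delta k). Proof. exact: l1_leW (l1_le_delta k). Qed.

Lemma conv_delta L k m :
  twisted_conv L (delta k) (delta m) = fun n => c L k m * delta (k + m) n.
Proof.
apply/funext => n; apply: (has_sum_unique (conv_has_sum L n (l1_delta k) (l1_delta m))).
set x := (fun _ => _); have -> : c L k m * delta (k + m) n = x k.
  rewrite /x deltaxx mul1r /delta subr_eq [m + k]addrC.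
  case: eqP => [->|_]; last by rewrite mulr0 mul0r.
  by rewrite addrAC subrr add0r mulr1 mul1r.
by apply: has_sum1 => j /delta_eq0 h; rewrite /x h !mul0r.
Qed.

Lemma star_delta L k :
  twisted_star L (delta k) = fun n => c L k k * delta (- k) n.
Proof.
apply/funext => n; rewrite /twisted_star /delta eqr_oppLR.
case: eqP => [->|_]; last by rewrite conjC0 mul0r mulr0.
by rewrite conjC1 mul1r mulr1 lattice_cocycleNl lattice_cocycleNr conjCK.
Qed.

End l1.

(** * Automatic continuity of representations *)
Section neumann.
Variable R : realType.

Lemma geometric_fset (r : R) : 0 <= r < 1 -> sum_le (fun j : nat => r ^+ j) (1 - r)^-1.
Proof.
move=> /andP[r0 r1] F; pose N := (\max_(j <- F) j).+1.
have -> : \sum_(j <- F) r ^+ j = \sum_(j < N | (j : nat) \in F) r ^+ j.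
  rewrite -(big_mkord (fun j => j \in F) (fun j => r ^+ j)) -big_filter.
  apply: perm_big; apply: uniq_perm; rewrite ?fset_uniq ?filter_uniq ?iota_uniq //.
  move=> j; rewrite mem_filter mem_index_iota /=; case jF: (j \in _) => //=.
  by rewrite ltnS; apply/esym; apply: leq_bigmax_seq.
apply: (@le_trans _ _ (\sum_(j < N) r ^+ j)).
  by rewrite [leRHS](bigID (fun j : 'I_N => (j : nat) \in F)) /= lerDl sumr_ge0 // => j _; rewrite exprn_ge0.
have d0 : 0 < 1 - r by rewrite subr_gt0.
rewrite -[leRHS]mul1r ler_pdivlMr // mulrC.
rewrite -[1 - r]opprB mulNr -subrX1 opprB.
by rewrite lerBlDr lerDl exprn_ge0.
Qed.

Lemma has_sum_shift (V : normedZmodType R[i]) (x : nat -> V) s :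
  has_sum x s -> has_sum (fun j => x j.+1) (s - x 0%N).
Proof.
move=> xs e /xs[F hF]; exists (predn @` F)%fset => G FG.
have := hF (0%N |` (S @` G))%fset; rewrite big_fsetU1; last first.
  by apply/imfsetP => -[].
rewrite big_imfset /=; last by move=> ? ? _ _ [].
rewrite opprD addrA; apply; apply/fsubsetP => -[|j] jF; first by rewrite in_fset1U.
rewrite in_fset1U; apply/orP; right; apply: in_imfset.
by apply: (fsubsetP FG); apply/imfsetP; exists j.+1.
Qed.

Variables (d : nat) (L : 'M[R]_(d + d)).

(** The index is shifted: [conv_pow g 0] is the first power of [g]. *)
Fixpoint conv_pow (g : lattice d -> R[i]) (j : nat) : lattice d -> R[i] :=
  if j is j'.+1 then twisted_conv L (conv_pow g j') g else g.

Lemma l1_le_conv_pow g r j : l1_le g r -> l1_le (conv_pow g j) (r * r ^+ j).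
Proof.
move=> gr; elim: j => [|j IH]; first by rewrite expr0 mulr1.
by rewrite exprSr mulrA; exact: l1_le_conv.
Qed.

(** [b] is the sum of all the powers of [g]; convolving it with [g] on the right
    shifts the series by one term, by Fubini. *)
Lemma neumann_series g r : 0 <= r < 1 -> l1_le g r ->
  exists2 b, l1 b & b = (fun n => g n + twisted_conv L b g n).
Proof.
move=> /[dup] r01 /andP[r0 r1] gr.
pose u (p : nat * lattice d) := rnorm (conv_pow g p.1 p.2).
have uM : sum_le u (r * (1 - r)^-1).
  apply: sum_le_triangle (sum_leZ r0 (geometric_fset r01)) => [p|j].
    exact: rnorm_ge0.
  exact: l1_le_conv_pow.
pose b n := csum (fun j => conv_pow g j n).
have bs n : has_sum (fun j => conv_pow g j n) (b n).
  exact: csum_has_sum (sum_le_row n (sum_le_swap uM)).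
have b1 : l1_le b (r * (1 - r)^-1).
  exact: (@sum_le_fubini _ _ _ _ (fun p => conv_pow g p.2 p.1) b bs _ (sum_le_swap uM)).
exists b; first exact: l1_leW b1.
have gl : l1 g := l1_leW gr; have bl := l1_leW b1.
apply/funext => n; apply/eqP; rewrite addrC -subr_eq; apply/eqP.
pose y (p : nat * lattice d) := conv_pow g p.1 p.2 * g (n - p.2) *
  lattice_cocycle L p.2 (n - p.2).
have yM : sum_le (fun p => rnorm (y p)) (r * (1 - r)^-1 * r).
  rewrite mulrC; apply: sum_le_mono (sum_leZ r0 uM) => p.
  rewrite !rnormM rnorm_lattice_cocycle mulr1 mulrC ler_wpM2r ?rnorm_ge0 //.
  exact: sum_le1 gr.
have yS := csum_has_sum yM.
have h1 : has_sum (fun j => conv_pow g j.+1 n) (csum y).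
  apply: (has_sum_fubini (x := y) _ yM yS) => j; apply: conv_has_sum => //.
  exact: l1_leW (l1_le_conv_pow j gr).
have h2 : has_sum (fun k => b k * g (n - k) * lattice_cocycle L k (n - k)) (csum y).
  apply: (has_sum_fubini (x := fun p => y (p.2, p.1)) _ (sum_le_swap yM) (has_sum_swap yS)) => k /=.
  pose C := g (n - k) * lattice_cocycle L k (n - k).
  have := has_sum_map (f := fun z : R[i] => z * C) (C := rnorm C) _ _ (bs k).
  rewrite -mulrA -/C (_ : _ \o _ = (fun j => y (j, k))).
    by apply=> [v w|v]; rewrite ?mulrDl // rnormM mulrC.
  by apply/funext => j; rewrite /y /= mulrA.
rewrite (has_sum_unique (conv_has_sum L n bl gl) h2).
exact: has_sum_unique (has_sum_shift (bs n)) h1.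
Qed.

End neumann.

Section star_representations.
Variables (R : realType) (d : nat) (L : 'M[R]_(d + d)).
Variables (H : normedModType R[i]) (ip : H -> H -> R[i]).
Variable P : (lattice d -> R[i]) -> H -> H.
Hypotheses (ipP : is_inner_product ip) (PP : is_star_rep L ip P).
Implicit Types (a b : lattice d -> R[i]).

Lemma rep_sub a x y : l1 a -> P a (x - y) = P a x - P a y.
Proof.
move=> al; have lin := rep_op_linear PP al.
by rewrite -[- y]scaleN1r addrC lin scaleN1r addrC.
Qed.

Lemma rep_scale a l x : l1 a -> P a (l *: x) = l *: P a x.
Proof.
move=> al; have lin := rep_op_linear PP al.
have P0 : P a 0 = 0 by have := rep_sub 0 0 al; rewrite !subrr.
by rewrite -[l *: x]addr0 lin P0 addr0.
Qed.

(** If [z] is the image of [y], then [||z||^2 = ip (P a z) y]. *)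
Lemma rep_star_bound a M : l1 a -> 0 <= M -> (forall x, rnorm (P a x) <= M * rnorm x) ->
  forall y, rnorm (P (twisted_star L a) y) <= M * rnorm y.
Proof.
move=> al M0 aM y; set z := P _ y.
have [z0|z0] := eqVneq (rnorm z) 0; first by rewrite z0 mulr_ge0 ?rnorm_ge0.
have zp : 0 < rnorm z by rewrite lt_def z0 rnorm_ge0.
rewrite -(ler_pM2l zp) -expr2.
have -> : rnorm z ^+ 2 = rnorm (ip (P a z) y).
  by rewrite (rep_star PP al) -/z (ipxx ipP) rnorm_real ger0_norm ?sqr_ge0.
apply: (le_trans (cauchy_schwarz ipP _ _)).
by rewrite mulrCA mulrA ler_wpM2r ?rnorm_ge0.
Qed.

Lemma rnorm_subsq x y : rnorm (x - y) ^+ 2 =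
  rnorm x ^+ 2 - 2 * complex.Re (ip x y) + rnorm y ^+ 2.
Proof.
have cN1 : (-1 : R[i])^* = -1 by rewrite rmorphN rmorph1.
have := ipxx ipP (x - y); rewrite -scaleN1r (ipDl ipP) !(ipDr ipP) !(ipZl ipP) !(ipZr ipP).
rewrite !(ipxx ipP) (ipC ipP x y) cN1 !mulN1r opprK => /(congr1 (@complex.Re R)).
rewrite !raddfD !raddfN /= scaleN1r => <-.
have -> : complex.Re ((ip x y)^*) = complex.Re (ip x y) by case: (ip x y).
by ring.
Qed.

Lemma rep_zero x : P (fun=> 0) x = 0.
Proof.
have l0 := @l1_zero R d.
have := rep_linear PP 1 l0 l0 x.
rewrite (_ : (fun _ => _) = (fun=> 0)); last by apply/funext => k; rewrite mulr0 addr0.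
by rewrite scale1r -[X in X = _]addr0 => /addrI.
Qed.

Lemma rep_scalel l a x : l1 a -> P (fun k => l * a k) x = l *: P a x.
Proof.
move=> al; have l0 := @l1_zero R d.
have := rep_linear PP l al l0 x; rewrite rep_zero addr0.
by rewrite (_ : (fun _ => _ + 0) = (fun k => l * a k)) //; apply/funext => k; rewrite addr0.
Qed.

(** Suppose that the norm [M] of [P a] exceeds the l1 norm of [a]. Then
    [g = M^-2 a^* * a] has l1 norm less than 1, so that it has a Neumann series
    in l1, whose image is a bounded operator; hence 1 is not an approximate
    eigenvalue of [P g]. But [M^2] is an approximate eigenvalue of
    [(P a)^* (P a)], with approximate eigenvectors the unit vectors that nearly
    realize the norm of [P a]. *)
Theorem rep_norm_le a C : l1_le a C -> forall x, rnorm (P a x) <= C * rnorm x.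
Proof.
move=> aC; have al := l1_leW aC; have C0 := sum_le_ge0 aC.
pose S := [set r | exists2 x, rnorm x <= 1 & r = rnorm (P a x)].
have S0 : S !=set0 by exists (rnorm (P a 0)); exists 0 => //; rewrite rnorm0.
have Sub : has_ubound S.
  have [B0 hB] := rep_op_bounded PP al; exists `|B0| => _ [x x1 ->].
  apply: (le_trans (hB x)); apply: (le_trans (ler_norm _)).
  by rewrite normrM ler_piMr // ger0_norm ?rnorm_ge0.
pose M := sup S.
have Pa0 : P a 0 = 0 by have := rep_sub 0 0 al; rewrite !subrr.
have aM x : rnorm (P a x) <= M * rnorm x.
  have [x0|x0] := eqVneq (rnorm x) 0.
    by rewrite (rnorm0_eq0 x0) Pa0 !rnorm0 mulr0.
  have xp : 0 < rnorm x by rewrite lt_def x0 rnorm_ge0.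
  rewrite -ler_pdivrMr // mulrC; apply: ub_le_sup => //.
  exists (real_complex R (rnorm x)^-1 *: x).
    by rewrite rnormZ rnorm_real ger0_norm ?invr_ge0 ?rnorm_ge0 // mulVf.
  by rewrite (rep_scale _ _ al) rnormZ rnorm_real ger0_norm ?invr_ge0 ?rnorm_ge0.
have M0 : 0 <= M by apply: ub_le_sup => //; exists 0; rewrite ?Pa0 rnorm0.
have [MC|CM] := leP M C; first by move=> x; rewrite (le_trans (aM x)) ?ler_wpM2r ?rnorm_ge0.
exfalso.
have Mp : 0 < M by apply: le_lt_trans CM.
pose h := twisted_conv L (twisted_star L a) a.
have hC : l1_le h (C * C) by apply: l1_le_conv => //; exact: l1_le_star.
have hl := l1_leW hC.
have Ph x : P h x = P (twisted_star L a) (P a x).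
  by rewrite (rep_mul PP) //; exact: l1_star.
pose g n := real_complex R (M^-1 ^+ 2) * h n.
have gr : l1_le g (M^-1 ^+ 2 * (C * C)).
  apply: sum_le_mono (sum_leZ (sqr_ge0 M^-1) hC) => n.
  by rewrite rnormM rnorm_real ger0_norm ?sqr_ge0.
have r01 : 0 <= M^-1 ^+ 2 * (C * C) < 1.
  rewrite mulr_ge0 ?sqr_ge0 ?mulr_ge0 //= -expr2 -exprMn mulrC.
  by rewrite expr_lt1 ?ltr_pdivrMr ?mul1r // divr_ge0.
have gl := l1_leW gr.
have [b bl bE] := neumann_series L r01 gr.
have [B' hB'] := rep_op_bounded PP bl; pose B := `|B'|.
have hB y : rnorm (P b y) <= B * rnorm y.
  by apply: (le_trans (hB' y)); rewrite ler_wpM2r ?rnorm_ge0 ?ler_norm.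
have Pg x : P g x = real_complex R (M^-1 ^+ 2) *: P h x by rewrite rep_scalel.
have Pb y : P b y = P g y + P b (P g y).
  rewrite {1}bE -(rep_mul PP) //.
  have := rep_linear PP 1 gl (l1_conv L bl gl) y; rewrite scale1r => <-.
  by congr (P _ y); apply/funext => n; rewrite mul1r.
(* [th] measures how nearly [x] realizes the norm; it is so small that
   [t ^+ 2 <= (1 + B) ^+ 2 * (1 - t ^+ 2)] fails for [t > 1 - th]. *)
pose th := (4 * (1 + (1 + B) ^+ 2))^-1.
have B0 : 0 <= B by exact: normr_ge0.
have D0 : 0 < 1 + (1 + B) ^+ 2 by rewrite ltr_wpDr ?sqr_ge0.
have th0 : 0 < th by rewrite invr_gt0 mulr_gt0.
have [_ [x x1 ->] hx] := sup_adherent (mulr_gt0 th0 Mp) (conj S0 Sub).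
rewrite -/M in hx.
pose t := M^-1 * rnorm (P a x); pose y := x - P g x.
have t0 : 0 <= t by rewrite mulr_ge0 ?invr_ge0 ?rnorm_ge0.
have t1 : 1 - th < t.
  by rewrite /t ltr_pdivlMl // mulrBr mulr1 [M * th]mulrC.
have tx : t <= rnorm x by rewrite /t ler_pdivrMl.
have iph : complex.Re (ip x (P g x)) = t ^+ 2.
  rewrite Pg (ipZr ipP) conj_real Ph -(rep_star PP al) (ipxx ipP) -rmorphM /=.
  by rewrite -exprMn.
have Pgt : rnorm (P g x) <= t.
  rewrite Pg rnormZ rnorm_real ger0_norm ?sqr_ge0 // Ph expr2 -mulrA ler_wpM2l ?invr_ge0 //.
  by rewrite ler_pdivrMl //; apply: rep_star_bound.
have yt : rnorm y ^+ 2 <= 1 - t ^+ 2.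
  rewrite rnorm_subsq iph.
  have : rnorm x ^+ 2 <= 1 by rewrite expr_le1 ?rnorm_ge0.
  have : rnorm (P g x) ^+ 2 <= t ^+ 2 by rewrite lerXn2r ?nnegrE ?rnorm_ge0.
  rnlra.
have Pby : P b y = P g x by rewrite (rep_sub _ _ bl) {1}Pb addrK.
have xy : rnorm x <= (1 + B) * rnorm y.
  rewrite -[x in rnorm x](subrK (P g x)) -/y (le_trans (rnormD _ _)) //.
  by rewrite mulrDl mul1r lerD2l -Pby.
have h1 : t ^+ 2 <= (1 + B) ^+ 2 * rnorm y ^+ 2.
  have b1 : 0 <= 1 + B by rewrite addr_ge0.
  rewrite -exprMn; apply: lerXn2r; rewrite ?nnegrE //.
    by rewrite mulr_ge0 ?rnorm_ge0.
  exact: le_trans tx xy.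
have h2 : t ^+ 2 <= (1 + B) ^+ 2 * (1 - t ^+ 2).
  by rewrite (le_trans h1) // ler_wpM2l ?sqr_ge0.
have h3 : th * (1 + (1 + B) ^+ 2) = 4^-1.
  by rewrite /th invfM -mulrA mulVf ?mulr1 ?gt_eqF.
have h4 : 1 - 2 * th <= t ^+ 2.
  have th1 : th <= 1 by rewrite invf_le1 ?mulr_gt0 //; have := sqr_ge0 (1 + B); lra.
  have : (1 - th) ^+ 2 <= t ^+ 2 by rewrite lerXn2r ?nnegrE ?subr_ge0 // ltW.
  by have := sqr_ge0 th; rewrite !expr2; lra.
move: h2 h3 h4; set q := (1 + B) ^+ 2; set w := t ^+ 2 => h2 h3 h4.
have q0 : 0 <= q by exact: sqr_ge0.
have : (1 + q) * w <= q by move: h2; lra.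
have : (1 + q) * (1 - 2 * th) <= (1 + q) * w by rewrite ler_wpM2l // addr_ge0.
by move: h3; lra.
Qed.

End star_representations.

(** * Representations and projective families of contractions *)
Section expansion.
Variables (R : realType) (d : nat) (V : normedModType R[i]).
Variables (Q : (lattice d -> R[i]) -> V) (K : R).
Hypothesis Q_linear : forall (l : R[i]) a b, l1 a -> l1 b ->
  Q (fun k => l * a k + b k) = l *: Q a + Q b.
Hypothesis Q_bounded : forall a C, l1_le a C -> rnorm (Q a) <= C * K.
Implicit Types (a b : lattice d -> R[i]).

Definition truncation (F : {fset lattice d}) a : lattice d -> R[i] :=
  fun n => \sum_(k <- F) a k * delta R k n.

Lemma l1_comb (I : Type) (r : seq I) (u : I -> R[i]) (f : I -> lattice d) :
  l1 (fun n => \sum_(k <- r) u k * delta R (f k) n).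
Proof.
elim: r => [|k r IH].
  rewrite (_ : (fun _ => _) = fun=> 0); first exact: l1_zero.
  by apply/funext => n; rewrite big_nil.
rewrite (_ : (fun _ => _) = (fun n => u k * delta R (f k) n + \sum_(k <- r) u k * delta R (f k) n)).
  exact: l1_lin (l1_delta _ _) IH.
by apply/funext => n; rewrite big_cons.
Qed.

Lemma truncationE F a n : truncation F a n = if n \in F then a n else 0.
Proof.
rewrite /truncation; case: ifPn => nF.
  rewrite (big_fsetD1 n) //= deltaxx mulr1 big1_fset ?addr0 // => k; rewrite in_fsetD1.
  by move=> /andP[kn _] _; rewrite delta_eq0 ?mulr0 // eq_sym.
rewrite big1_fset // => k kF _; rewrite delta_eq0 ?mulr0 //.
by apply: contraNneq nF => ->.
Qed.

Lemma Q_zero : Q (fun=> 0) = 0.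
Proof.
have := Q_linear 1 (@l1_zero R d) (@l1_zero R d).
rewrite (_ : (fun _ => _) = (fun=> 0)); last by apply/funext => k; rewrite mulr0 addr0.
by rewrite scale1r -[X in X = _]addr0 => /addrI.
Qed.

Lemma Q_comb (I : Type) (r : seq I) (u : I -> R[i]) (f : I -> lattice d) :
  Q (fun n => \sum_(k <- r) u k * delta R (f k) n) = \sum_(k <- r) u k *: Q (delta R (f k)).
Proof.
elim: r => [|k r IH].
  by rewrite big_nil -Q_zero; congr Q; apply/funext => n; rewrite big_nil.
rewrite big_cons -IH -Q_linear; [|exact: l1_delta|exact: l1_comb].
by congr Q; apply/funext => n; rewrite big_cons.
Qed.

Lemma l1_le_tail F a e :
  (forall G, [disjoint F & G]%fset -> \sum_(i <- G) rnorm (a i) <= e) ->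
  l1_le (fun n => (-1) * truncation F a n + a n) e.
Proof.
move=> tl G; rewrite (big_fsetID _ (mem F)) /= [X in X + _]big1_fset => [|k]; last first.
  by rewrite !inE truncationE => /andP[_ /= ->] _; rewrite mulN1r addNr rnorm0.
rewrite add0r; set G' := [fset _ | _ in _ & _]%fset.
have dj : [disjoint F & G']%fset.
  by apply/fdisjointP => k kF; rewrite !inE kF andbF.
apply: le_trans (tl _ dj); rewrite le_eqVlt; apply/orP; left; apply/eqP.
apply: eq_fbigr => k; rewrite !inE truncationE => /andP[_ /negPf->] _.
by rewrite mulr0 add0r.
Qed.

(** On finitely supported elements this is linearity, and the bound on [Q] makes
    the image of the remaining tail small. *)
Lemma l1_expansion a : l1 a -> has_sum (fun k => a k *: Q (delta R k)) (Q a).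
Proof.
move=> /[dup] al /l1P[C aC] e e0.
have K0 : 0 < `|K| + 1 by rewrite ltr_wpDl.
have [F hF] := sum_le_tail (fun i => rnorm_ge0 (a i)) aC (divr_gt0 e0 K0).
exists F => G FG; rewrite -Q_comb -/(truncation G a).
have -> : Q a - Q (truncation G a) = Q (fun n => (-1) * truncation G a n + a n).
  rewrite Q_linear //; last exact: l1_comb.
  by rewrite scaleN1r addrC.
have tl : forall G', [disjoint G & G']%fset ->
    \sum_(i <- G') rnorm (a i) <= e / (`|K| + 1).
  by move=> G' dj; apply: hF; exact: fdisjointWl dj.
apply: (le_trans (Q_bounded (l1_le_tail tl))).
rewrite mulrAC ler_pdivrMr //; apply: ler_wpM2l; first exact: ltW.
by apply: (le_trans (ler_norm K)); rewrite lerDl.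
Qed.

End expansion.

Section integrated_form.
Variables (R : realType) (d : nat) (L : 'M[R]_(d + d)).
Variables (K : completeNormedModType R[i]) (ip : K -> K -> R[i]).
Variable W : lattice d -> K -> K.
Hypothesis ipP : is_inner_product ip.
Hypothesis W_linear : forall k, linear (W k).
Hypothesis W_contract : forall k x, rnorm (W k x) <= rnorm x.
Hypothesis W_mul : forall k m x,
  W k (W m x) = lattice_cocycle L k m *: W (k + m) x.
Hypothesis W_adj : forall k x y,
  ip (W k x) y = ip x (lattice_cocycle L k k *: W (- k) y).
Implicit Types (a b : lattice d -> R[i]) (x y : K).

(** The series converges for [a] in l1, so that the default value 0 of [xget] is
    then irrelevant. *)
Definition integrated a x : K :=
  xget 0 [set s | has_sum (fun k => a k *: W k x) s].

Lemma integrated_le a C x : l1_le a C ->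
  sum_le (fun k => rnorm (a k *: W k x)) (rnorm x * C).
Proof.
move=> aC; apply: sum_le_mono (sum_leZ (rnorm_ge0 x) aC) => k.
by rewrite rnormZ mulrC ler_wpM2r ?rnorm_ge0.
Qed.

Lemma integrated_has_sum a x : l1 a -> has_sum (fun k => a k *: W k x) (integrated a x).
Proof.
move=> /l1P[C aC]; rewrite /integrated; case: xgetP => // h.
by have [s hs] := has_sum_complete (integrated_le x aC); have := h s.
Qed.

Lemma W_add k x y : W k (x + y) = W k x + W k y.
Proof. by have := W_linear k 1 x y; rewrite !scale1r. Qed.

Lemma W_scale k l x : W k (l *: x) = l *: W k x.
Proof.
have W0 : W k 0 = 0 by apply: (addrI (W k 0)); rewrite -W_add !addr0.
by rewrite -[l *: x]addr0 W_linear W0 addr0.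
Qed.

(** Multiplicativity is Fubini for the double series of the
    [a k * b m *: W k (W m x)], regrouped along [n = k + m]. *)
Theorem integrated_star_rep : is_star_rep L ip integrated.
Proof.
split.
- move=> a al l x y; apply: (has_sum_unique (integrated_has_sum _ al)).
  apply: eq_has_sum (has_sumD (has_sumZ l (integrated_has_sum x al)) (integrated_has_sum y al)) => k.
  by rewrite W_linear scalerDr !scalerA mulrC.
- move=> a /[dup] al /l1P[C aC]; exists C => x.
  rewrite mulrC; exact: has_sum_le (integrated_le x aC) (integrated_has_sum x al).
- move=> l a b al bl x; apply: (has_sum_unique (integrated_has_sum _ (l1_lin l al bl))).
  apply: eq_has_sum (has_sumD (has_sumZ l (integrated_has_sum x al)) (integrated_has_sum x bl)) => k.
  by rewrite scalerDl scalerA.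
- move=> a b /[dup] al /l1P[M aM] /[dup] bl /l1P[N bN] x.
  pose z (p : lattice d * lattice d) := conv_term L a b p *: W p.1 x.
  have zM : sum_le (fun p => rnorm (z p)) (rnorm x * (M * N)).
    apply: sum_le_mono (sum_leZ (rnorm_ge0 x) (sum_le_conv L aM bN)) => p.
    by rewrite rnormZ mulrC ler_wpM2r ?rnorm_ge0.
  have [S zS] := has_sum_complete zM.
  have h1 : has_sum (fun n => twisted_conv L a b n *: W n x) S.
    apply: (has_sum_fubini (x := z) _ zM zS) => n.
    exact: has_sumZl (conv_has_sum L n al bl).
  have h2 : has_sum (fun k => a k *: W k (integrated b x)) S.
    pose f (p : lattice d * lattice d) := (p.1 + p.2, p.1).
    pose g (p : lattice d * lattice d) := (p.2, p.1 - p.2).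
    have fg : cancel f g by move=> [k m]; rewrite /f /g /= addrAC subrr add0r.
    have gf : cancel g f by move=> [n k]; rewrite /f /g /= addrC subrK.
    have fE p : (z \o f) p = a p.1 *: W p.1 (b p.2 *: W p.2 x).
      case: p => k m; rewrite /z /f /conv_term /=.
      have -> : k + m - k = m by rewrite addrAC subrr add0r.
      by rewrite W_scale W_mul !scalerA.
    apply: (has_sum_fubini (x := z \o f) _ (sum_le_inj (can_inj fg) zM) (has_sum_bij fg gf zS)) => k.
    have hk : has_sum (fun m => W k (b m *: W m x)) (W k (integrated b x)).
      apply: (has_sum_map (C := 1)) (integrated_has_sum x bl); first exact: W_add.
      by move=> v; rewrite mul1r.
    by apply: eq_has_sum (has_sumZ (a k) hk) => m; rewrite fE.
  have := has_sum_unique (integrated_has_sum x (l1_conv L al bl)) h1 => ->.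
  exact: has_sum_unique h2 (integrated_has_sum _ al).
- move=> a al x y.
  have h1 : has_sum (fun k => ip (a k *: W k x) y) (ip (integrated a x) y).
    apply: (has_sum_map (f := ip^~ y) (C := rnorm y)) (integrated_has_sum x al).
      by move=> u v; rewrite (ipDl ipP).
    by move=> v; rewrite mulrC; exact: cauchy_schwarz.
  have h2 : has_sum (fun n => ip x (twisted_star L a n *: W n y))
      (ip x (integrated (twisted_star L a) y)).
    apply: (has_sum_map (f := ip x) (C := rnorm x)) (integrated_has_sum y (l1_star L al)).
      by move=> u v; rewrite (ipDr ipP).
    by move=> v; exact: cauchy_schwarz.
  apply: (has_sum_unique h1).
  apply: eq_has_sum (has_sum_bij (@opprK _) (@opprK _) h2) => k /=.
  rewrite /twisted_star opprK lattice_cocycleNl lattice_cocycleNr conjCK.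
  by rewrite -scalerA (ipZr ipP) conjCK (ipZl ipP) W_adj.
Qed.

End integrated_form.

(** * Almost invariant vectors on the lattice *)
Section almost_invariant.
Variables (R : realType) (d : nat).
Implicit Types (k n m : lattice d).

Definition norm1 (k : lattice d) : nat := (\sum_(i < d + d) `|k i ord0|)%N.

Lemma norm1D k n : (norm1 (k + n)%R <= norm1 k + norm1 n)%N.
Proof.
rewrite /norm1 -big_split /= leq_sum // => i _; rewrite mxE.
by rewrite -lez_nat PoszD !abszE ler_normD.
Qed.

Lemma norm1N k : norm1 (- k)%R = norm1 k.
Proof. by rewrite /norm1; apply: eq_bigr => i _; rewrite mxE abszN. Qed.

Lemma bernoulli (t : R) N : 0 <= t <= 1 -> 1 - N%:R * t <= (1 - t) ^+ N.
Proof.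
move=> /andP[t0 t1]; elim: N => [|N IH]; first by rewrite mul0r subr0 expr0.
have t2 : 0 <= 1 - t by rewrite subr_ge0.
rewrite exprSr; apply: le_trans (ler_wpM2r t2 IH); rewrite -[N.+1]addn1 natrD.
have : 0 <= N%:R * t * t by rewrite !mulr_ge0.
by set x := N%:R; lra.
Qed.

Lemma sum_le_int (q : R) : 0 <= q < 1 ->
  sum_le (fun j : int => q ^+ `|j|%N) ((1 - q)^-1 * 2).
Proof.
move=> q01; have q0 : 0 <= q by case/andP: q01.
pose f (j : int) := (`|j|%N, j < 0).
have finj : injective f by move=> [m|m] [n|n] //= [] => // ->.
have b2 : sum_le (fun _ : bool => 1 : R) 2.
  move=> F; apply: (le_trans (ler_sum_fset (fun _ => ler01) (_ : (F `<=` [fset true; false])%fset))).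
    by apply/fsubsetP => -[]; rewrite !inE.
  rewrite big_fsetU1 ?inE // big_seq_fset1 /=; lra.
have := sum_le_inj finj (sum_le_prod (fun j : nat => exprn_ge0 j q0) (fun _ : bool => ler01) (geometric_fset q01) b2).
by apply: sum_le_mono => j /=; rewrite mulr1.
Qed.

(** By induction on the number of coordinates, the weight being a product. *)
Lemma sum_le_col (q : R) N : 0 <= q < 1 ->
  exists M, sum_le (fun k : 'cV[int]_N => \prod_(i < N) q ^+ `|k i ord0|%N) M.
Proof.
move=> q01; have q0 : 0 <= q by case/andP: q01.
elim: N => [|N [M hM]].
  exists 1 => F; apply: (le_trans (ler_sum_fset _ (_ : (F `<=` [fset 0])%fset))).
  - by move=> k; rewrite big_ord0 ler01.
  - by apply/fsubsetP => k _; rewrite inE; apply/eqP/matrixP => -[].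
  - by rewrite big_seq_fset1 big_ord0.
exists ((1 - q)^-1 * 2 * M).
pose f (k : 'cV[int]_N.+1) := (k ord0 ord0, \col_i k (lift ord0 i) ord0 : 'cV[int]_N).
have finj : injective f.
  move=> k k' [h0 /matrixP h]; apply/matrixP => i j; rewrite !ord1.
  by case: (unliftP ord0 i) => [i' ->|-> //]; have := h i' ord0; rewrite !mxE.
have p0 (k : 'cV[int]_N) : 0 <= \prod_(i < N) q ^+ `|k i ord0|%N.
  by apply: prodr_ge0 => i _; rewrite exprn_ge0.
have := sum_le_inj finj (sum_le_prod (fun j : int => exprn_ge0 `|j|%N q0) p0 (sum_le_int q01) hM).
apply: sum_le_mono => k; rewrite big_ord_recl /=.
by under [in leRHS]eq_bigr do rewrite mxE.
Qed.

(** The weights [q ^+ norm1 n] are square summable, and for [q] close to 1 a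
    translation multiplies them by factors close to 1: this is the amenability
    of the lattice. *)
Lemma almost_invariant_vector (F : {fset lattice d}) (rho : R) : 0 < rho ->
  exists (phi : lattice d -> R) (M : R),
  [/\ forall n, 0 <= phi n, phi 0 = 1, sum_le (fun n => phi n ^+ 2) M
    & forall k n, k \in F -> `|phi (n - k) - phi n| <= rho * phi n].
Proof.
move=> rho0; pose N := (\max_(k <- F) norm1 k)%N.
have rho1 : 0 < 1 + rho by rewrite ltr_wpDr // ltW.
have N0 : 0 < N.+1%:R :> R by [].
(* By Bernoulli's inequality this [t] gives [(1 - t) ^+ N.+1 >= 1 / (1 + rho)]. *)
pose t := rho / (1 + rho) / N.+1%:R.
have t0 : 0 < t by rewrite !divr_gt0.
have Nt : N.+1%:R * t = rho / (1 + rho) by rewrite /t mulrC divfK ?gt_eqF.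
have rr : rho / (1 + rho) < 1 by rewrite ltr_pdivrMr // mul1r ltrDr.
have t1 : t < 1.
  by apply: le_lt_trans rr; rewrite -Nt ler_peMl ?(ltW t0) // ler1n.
pose q : R := 1 - t; have q0 : 0 < q by rewrite subr_gt0.
have q1 : q < 1 by rewrite ltrBlDr ltrDl.
pose phi (n : lattice d) : R := q ^+ norm1 n.
have phi0 n : 0 < phi n by rewrite exprn_gt0.
have [M hM] : exists M, sum_le (fun n : lattice d => phi n ^+ 2) M.
  have q2 : 0 <= q ^+ 2 < 1 by rewrite sqr_ge0 expr_lt1 ?ltW.
  have [M hM] := sum_le_col (d + d) q2; exists M; apply: sum_le_mono hM => k.
  by rewrite /phi /norm1 -exprM mulnC exprM -expr_sum.
exists phi, M; split=> [n||//|k n kF].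
- exact: ltW.
- by rewrite /phi /norm1 big1 // => i _; rewrite mxE.
pose s : R := q ^+ norm1 k.
have s0 : 0 < s by rewrite exprn_gt0.
have sr : 1 <= s * (1 + rho).
  rewrite -ler_pdivrMr // mul1r; apply: (@le_trans _ _ (q ^+ N.+1)).
    apply: le_trans (bernoulli _ _); last by rewrite !ltW.
    rewrite Nt le_eqVlt; apply/orP; left; apply/eqP; field; exact: lt0r_neq0.
  rewrite ler_wiXn2l ?ltW // ltnW // ltnS; exact: leq_bigmax_seq.
have mono (m m' : nat) : (m <= m')%N -> q ^+ m' <= q ^+ m by move=> h; rewrite ler_wiXn2l ?ltW.
have h1 : s * phi n <= phi (n - k).
  by rewrite -exprD mono // addnC -[norm1 k]norm1N norm1D.
have h2 : s * phi (n - k) <= phi n.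
  by rewrite -exprD mono // addnC -{1}[n](subrK k) norm1D.
have := phi0 n; have := phi0 (n - k).
move: sr h1 h2 s0; set A := phi n; set B := phi (n - k) => sr h1 h2 s0 B0 A0.
have s1 : s <= 1 by rewrite exprn_ile1 ?ltW.
have B1 : B <= (1 + rho) * A.
  apply: (@le_trans _ _ (s * (1 + rho) * B)); first by rewrite ler_peMl // ltW.
  by rewrite mulrAC mulrC ler_wpM2l // ltW.
have A1 : (1 - rho) * A <= s * A.
  rewrite ler_wpM2r ?(ltW A0) //; have : s * rho <= rho by rewrite ler_piMl ?(ltW rho0).
  by move: sr; rewrite mulrDr mulr1; set u := s * rho; lra.
rewrite ler_norml; move: B1 A1; rewrite mulrDl mulrBl !mul1r => ? ?.
by apply/andP; split; lra.
Qed.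

End almost_invariant.

(** * Comparison of the universal norms of two matrices *)
Section universal_norm.
Variables (R : realType) (d : nat) (L : 'M[R]_(d + d)).
Implicit Types (a : lattice d -> R[i]).

Lemma universal_norm_ge0 a : 0 <= universal_norm L a.
Proof.
rewrite /universal_norm; set S := [set _ | _].
have [[r Sr]|S0] := pselect (S !=set0); last first.
  by rewrite (_ : S = set0) ?sup0 // -subset0 => r Sr; apply: S0; exists r.
have [Sub|nS] := pselect (has_ubound S); last by rewrite sup_out // => -[].
apply: le_trans (ub_le_sup Sub Sr).
by have [H [ip [P [x [_ _ _ ->]]]]] := Sr; exact: rnorm_ge0.
Qed.

Lemma universal_norm_le a B : 0 <= B ->
  (forall (H : completeNormedModType R[i]) (ip : H -> H -> R[i]) P x,
     is_inner_product ip -> is_star_rep L ip P -> rnorm x <= 1 ->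
     rnorm (P a x) <= B) ->
  universal_norm L a <= B.
Proof.
move=> B0 h; rewrite /universal_norm; set S := [set _ | _].
have [S0|S0] := pselect (S !=set0); last first.
  by rewrite (_ : S = set0) ?sup0 // -subset0 => r Sr; apply: S0; exists r.
by apply: ge_sup => // r [H [ip [P [x [ipP PP x1 ->]]]]]; exact: h PP x1.
Qed.

Lemma universal_norm_le_l1 a C : l1_le a C -> universal_norm L a <= C.
Proof.
move=> aC; have C0 := sum_le_ge0 aC; apply: universal_norm_le => // H ip P x ipP PP x1.
by rewrite (le_trans (rep_norm_le ipP PP aC x)) // ler_piMr.
Qed.

(** Automatic continuity bounds the set whose supremum is taken; the supremum of
    an unbounded set would be 0. *)
Lemma le_universal_norm a (H : completeNormedModType R[i]) (ip : H -> H -> R[i]) P x :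
  l1 a -> is_inner_product ip -> is_star_rep L ip P ->
  rnorm (P a x) <= universal_norm L a * rnorm x.
Proof.
move=> /[dup] al /l1P[C aC] ipP PP; have C0 := sum_le_ge0 aC.
have [x0|x0] := eqVneq (rnorm x) 0.
  by have := rep_norm_le ipP PP aC x; rewrite x0 !mulr0.
have xp : 0 < rnorm x by rewrite lt_def x0 rnorm_ge0.
rewrite -ler_pdivrMr // mulrC; apply: ub_le_sup.
  exists C => _ [H' [ip' [P' [x' [ipP' PP' x1 ->]]]]].
  by rewrite (le_trans (rep_norm_le ipP' PP' aC x')) // ler_piMr.
have ri : rnorm (real_complex R (rnorm x)^-1) = (rnorm x)^-1.
  by rewrite rnorm_real ger0_norm ?invr_ge0 ?rnorm_ge0.
exists H, ip, P, (real_complex R (rnorm x)^-1 *: x); split=> //.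
  by rewrite rnormZ ri mulVf.
by rewrite (rep_scale PP) // rnormZ ri.
Qed.

End universal_norm.

Section twisting.
Variables (R : realType) (d : nat) (L L' : 'M[R]_(d + d)).
Variables (H : completeNormedModType R[i]) (ip : H -> H -> R[i]).
Variable P : (lattice d -> R[i]) -> H -> H.
Hypotheses (ipP : is_inner_product ip) (PP : is_star_rep L ip P).
Implicit Types (a : lattice d -> R[i]) (k m n : lattice d) (x : H).

Notation V k := (P (delta R k)).
Notation K := (l2 (lattice d) H).

Definition cocycle_ratio k m : R[i] :=
  lattice_cocycle L' k m * (lattice_cocycle L k m)^*.

Lemma rnorm_ratio k m : rnorm (cocycle_ratio k m) = 1.
Proof. by rewrite rnormM rnormJ !rnorm_lattice_cocycle mulr1. Qed.

Lemma ratioDl k k' m :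
  cocycle_ratio (k + k') m = cocycle_ratio k m * cocycle_ratio k' m.
Proof. by rewrite /cocycle_ratio !lattice_cocycleDl rmorphM /= mulrACA. Qed.

Lemma ratioDr k m m' :
  cocycle_ratio k (m + m') = cocycle_ratio k m * cocycle_ratio k m'.
Proof. by rewrite /cocycle_ratio !lattice_cocycleDr rmorphM /= mulrACA. Qed.

Lemma ratioNl k m : cocycle_ratio (- k) m = (cocycle_ratio k m)^*.
Proof. by rewrite /cocycle_ratio !lattice_cocycleNl rmorphM /=. Qed.

Lemma ratioK k m : cocycle_ratio k m * lattice_cocycle L k m = lattice_cocycle L' k m.
Proof. by rewrite /cocycle_ratio mulrAC -mulrA mul_conj_lattice_cocycle mulr1. Qed.

Lemma ratio_conjK k m : cocycle_ratio k m * (cocycle_ratio k m)^* = 1.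
Proof. by rewrite mul_conj_rnorm rnorm_ratio expr1n. Qed.

Lemma V_linear k : linear (V k).
Proof. exact: (rep_op_linear PP (l1_delta _ k)). Qed.

Lemma V_contract k x : rnorm (V k x) <= rnorm x.
Proof. by have := rep_norm_le ipP PP (@l1_le_delta R d k) x; rewrite mul1r. Qed.

Lemma V_mul k m x : V k (V m x) = lattice_cocycle L k m *: V (k + m) x.
Proof.
rewrite -(rep_mul PP); try exact: l1_delta.
by rewrite conv_delta (rep_scalel PP) //; exact: l1_delta.
Qed.

Lemma V_adj k x y : ip (V k x) y = ip x (lattice_cocycle L k k *: V (- k) y).
Proof.
rewrite (rep_star PP); last exact: l1_delta.
by rewrite star_delta (rep_scalel PP) //; exact: l1_delta.
Qed.

Definition l2_of (g : lattice d -> H) : K := insubd 0 g.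

Lemma l2_ofE g M n : sum_le (fun i => rnorm (g i) ^+ 2) M -> l2_of g n = g n.
Proof.
move=> gM; have : g \in @square_summable R (lattice d) H by apply/asboolP; exists M.
by move=> gP; have h := insubdK (0 : K) gP; exact: (congr1 (fun u => u n) h).
Qed.

Lemma rnorm_l2_le (f : K) C : 0 <= C ->
  sum_le (fun i => rnorm (f i) ^+ 2) (C ^+ 2) -> rnorm f <= C.
Proof. exact: l2norm_le. Qed.

Lemma sum_le_rnorm_l2 (f : K) : sum_le (fun i => rnorm (f i) ^+ 2) (rnorm f ^+ 2).
Proof. exact: sum_le_l2norm. Qed.

(** The tensor product of [P] with the left regular representation of the
    lattice twisted by the quotient of the two cocycles. *)
Definition twist k (f : K) : K := l2_of (fun n => cocycle_ratio k (n - k) *: V k (f (n - k))).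

Lemma twist_bound k (f : K) :
  sum_le (fun n => rnorm (cocycle_ratio k (n - k) *: V k (f (n - k))) ^+ 2) (rnorm f ^+ 2).
Proof.
apply: sum_le_mono (sum_le_inj (addIr (- k)) (@sum_le_rnorm_l2 f)) => n /=.
by rewrite rnormZ rnorm_ratio mul1r lerXn2r ?nnegrE ?rnorm_ge0 ?V_contract.
Qed.

Lemma twistE k (f : K) n : twist k f n = cocycle_ratio k (n - k) *: V k (f (n - k)).
Proof. exact: l2_ofE (twist_bound k f). Qed.

Lemma twist_linear k : linear (twist k).
Proof.
move=> l f g; apply: l2_eqP => n; rewrite twistE l2E_add l2E_scale V_linear.
by rewrite l2E_add l2E_scale !twistE scalerDr !scalerA mulrC.
Qed.

Lemma twist_contract k (f : K) : rnorm (twist k f) <= rnorm f.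
Proof.
apply: rnorm_l2_le; first exact: rnorm_ge0.
by apply: sum_le_mono (twist_bound k f) => n; rewrite twistE.
Qed.

Lemma twist_mul k m f : twist k (twist m f) = lattice_cocycle L' k m *: twist (k + m) f.
Proof.
apply: l2_eqP => n; rewrite l2E_scale !twistE.
have lin := V_linear k.
rewrite (rep_scale PP) ?V_mul; last exact: l1_delta.
rewrite !scalerA opprD addrA; congr (_ *: _).
rewrite -{1}[n - k](subrK m) (ratioDr k (n - k - m) m) ratioDl -(ratioK k m).
by ring.
Qed.

Lemma twist_adj k (f g : K) :
  l2ip ip (twist k f) g = l2ip ip f (lattice_cocycle L' k k *: twist (- k) g).
Proof.
apply: (has_sum_unique (l2ip_has_sum ipP _ _)).
have h := has_sum_bij (addrNK k) (addrK k)
  (l2ip_has_sum ipP f (lattice_cocycle L' k k *: twist (- k) g)).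
apply: eq_has_sum h => n; rewrite /comp l2E_scale !twistE opprK subrK.
rewrite (ipZl ipP) V_adj !(ipZr ipP) !mulrA; congr (_ * _).
rewrite -(ratioK k k) ratioNl -{1}[n](subrK k) (ratioDr k (n - k) k) conjCK.
move: (ratio_conjK k k); set s := cocycle_ratio k k; set r := cocycle_ratio k (n - k).
move: s r => s r ss; rewrite rmorphM /= -[RHS]mulr1 -ss; ring.
Qed.

Lemma l2ip_innerP : is_inner_product (@l2ip R (lattice d) H ip).
Proof. exact: l2ip_inner. Qed.

Lemma twisted_star_rep :
  is_star_rep L' (@l2ip R (lattice d) H ip) (integrated twist).
Proof.
apply: integrated_star_rep.
- exact: l2ip_innerP.
- exact: twist_linear.
- exact: twist_contract.
- exact: twist_mul.
- exact: twist_adj.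
Qed.

End twisting.

Section tensor.
Variables (R : realType) (d : nat) (H : completeNormedModType R[i]).
Variables (phi : lattice d -> R) (M : R).
Hypotheses (phi_ge0 : forall n, 0 <= phi n) (phi0 : phi 0 = 1).
Hypothesis phiM : sum_le (fun n => phi n ^+ 2) M.
Notation K := (l2 (lattice d) H).
Implicit Types (x y : H) (n k : lattice d).

Lemma rnorm_l2_mono (f g : K) : (forall n, rnorm (f n) <= rnorm (g n)) ->
  rnorm f <= rnorm g.
Proof.
move=> fg; apply: rnorm_l2_le; first exact: rnorm_ge0.
apply: sum_le_mono (@sum_le_rnorm_l2 _ _ _ g) => n.
by rewrite lerXn2r ?nnegrE ?rnorm_ge0.
Qed.

Definition tensor x : K := l2_of (fun n => real_complex R (phi n) *: x).

Lemma tensor_bound x :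
  sum_le (fun n => rnorm (real_complex R (phi n) *: x) ^+ 2) (rnorm x ^+ 2 * M).
Proof.
apply: sum_le_mono (sum_leZ (sqr_ge0 (rnorm x)) phiM) => n.
by rewrite rnormZ rnorm_real exprMn real_normK ?num_real // mulrC.
Qed.

Lemma tensorE x n : tensor x n = real_complex R (phi n) *: x.
Proof. exact: l2_ofE (tensor_bound x). Qed.

Lemma rnorm_tensorE x n : rnorm (tensor x n) = phi n * rnorm x.
Proof. by rewrite tensorE rnormZ rnorm_real ger0_norm. Qed.

Lemma tensorD x y : tensor (x + y) = tensor x + tensor y.
Proof. by apply: l2_eqP => n; rewrite l2E_add !tensorE scalerDr. Qed.

Lemma tensorZ l x : tensor (l *: x) = l *: tensor x.
Proof. by apply: l2_eqP => n; rewrite l2E_scale !tensorE !scalerA mulrC. Qed.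

Lemma tensor_le x : rnorm (tensor x) <= Num.sqrt M * rnorm x.
Proof.
have M0 := sum_le_ge0 phiM.
apply: rnorm_l2_le; first by rewrite mulr_ge0 ?sqrtr_ge0 ?rnorm_ge0.
rewrite exprMn sqr_sqrtr // mulrC.
by apply: sum_le_mono (tensor_bound x) => n; rewrite tensorE.
Qed.

Lemma le_tensor x : rnorm x <= rnorm (tensor x).
Proof.
by have := rnorm_l2_coord (tensor x) 0; rewrite rnorm_tensorE phi0 mul1r.
Qed.

Lemma tensor_mono x y : rnorm x <= rnorm y -> rnorm (tensor x) <= rnorm (tensor y).
Proof. by move=> xy; apply: rnorm_l2_mono => n; rewrite !rnorm_tensorE ler_wpM2l. Qed.

(** After multiplication by these norms the two families have the same norm in
    each coordinate. *)
Lemma tensor_norm x y : rnorm (tensor y) * rnorm x = rnorm (tensor x) * rnorm y.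
Proof.
have key u v : rnorm (tensor u) * rnorm v <= rnorm (tensor v) * rnorm u.
  rewrite mulrC [leRHS]mulrC.
  have e w : rnorm (real_complex R (rnorm w)) = rnorm w.
    by rewrite rnorm_real ger0_norm ?rnorm_ge0.
  have h1 := rnormZ (real_complex R (rnorm v)) (tensor u).
  have h2 := rnormZ (real_complex R (rnorm u)) (tensor v).
  rewrite !e in h1 h2; rewrite -h1 -h2 -!tensorZ; apply: tensor_mono.
  by rewrite !rnormZ !e mulrC.
by apply/eqP; rewrite eq_le !key.
Qed.

Section twist_tensor.
Variables (L L' : 'M[R]_(d + d)) (ip : H -> H -> R[i]).
Variable P : (lattice d -> R[i]) -> H -> H.
Hypotheses (ipP : is_inner_product ip) (PP : is_star_rep L ip P).
Variables (k : lattice d) (rho eta theta : R) (G : {fset lattice d}).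
Hypotheses (eta0 : 0 <= eta) (theta0 : 0 <= theta).
Hypothesis phi_inv : forall n, `|phi (n - k) - phi n| <= rho * phi n.
Hypothesis phi_tail : forall G' : {fset lattice d}, [disjoint G & G']%fset ->
  \sum_(n <- G') phi n ^+ 2 <= theta ^+ 2.
Hypothesis ratio1 : forall n, n \in G -> rnorm (cocycle_ratio L L' k n - 1) <= eta.

(** The error has a phase part [a] and a translation part [b]. The factor
    [cocycle_ratio - 1] is at most [eta] on [G] and at most 2 elsewhere, where
    the mass of [phi] is at most [theta ^+ 2]; the translation part is
    controlled by [phi_inv]. *)
Lemma twist_tensor x :
  rnorm (twist L L' P k (tensor x) - tensor (P (delta R k) x)) <=
  (eta + 2 * theta + rho) * rnorm (tensor x).
Proof.
have rho0 : 0 <= rho by have := phi_inv 0; rewrite phi0 mulr1; apply: le_trans.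
pose E := rnorm (tensor x); have E0 : 0 <= E by exact: rnorm_ge0.
have Vx := V_contract ipP PP k x.
pose a n := ((cocycle_ratio L L' k (n - k) - 1) * real_complex R (phi (n - k))) *: P (delta R k) x.
pose b n := (real_complex R (phi (n - k)) - real_complex R (phi n)) *: P (delta R k) x.
have aE : sum_le (fun n => rnorm (a n) ^+ 2) (((eta + 2 * theta) * E) ^+ 2).
  have tl : sum_le (fun n => if n \in G then 0 else phi n ^+ 2) (theta ^+ 2).
    move=> F; rewrite (big_fsetID _ (mem G)) /= [X in X + _]big1_fset ?add0r => [|n]; last first.
      by rewrite !inE => /andP[_ /= ->].
    have dj : [disjoint G & [fset n in F | n \notin G]]%fset.
      by apply/fdisjointP => n nG; rewrite !inE nG andbF.
    apply: le_trans (phi_tail dj); rewrite le_eqVlt; apply/orP; left; apply/eqP.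
    by apply: eq_fbigr => n; rewrite !inE => /andP[_ /negPf ->].
  have h : sum_le (fun n => eta ^+ 2 * rnorm (tensor x n) ^+ 2 +
      4 * rnorm x ^+ 2 * (if n \in G then 0 else phi n ^+ 2))
      (eta ^+ 2 * E ^+ 2 + 4 * rnorm x ^+ 2 * theta ^+ 2).
    apply: sum_leD; apply: sum_leZ => //; first exact: sqr_ge0.
      exact: sum_le_rnorm_l2.
    by rewrite mulr_ge0 ?sqr_ge0.
  apply: (@sum_le_trans _ _ _ (eta ^+ 2 * E ^+ 2 + 4 * rnorm x ^+ 2 * theta ^+ 2)); last first.
    have xE : rnorm x ^+ 2 <= E ^+ 2 by rewrite lerXn2r ?nnegrE ?rnorm_ge0 ?le_tensor.
    apply: (@le_trans _ _ (eta ^+ 2 * E ^+ 2 + 4 * E ^+ 2 * theta ^+ 2)).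
      by rewrite lerD2l ler_wpM2r ?sqr_ge0 // ler_wpM2l.
    rewrite -subr_ge0; have -> : ((eta + 2 * theta) * E) ^+ 2 -
      (eta ^+ 2 * E ^+ 2 + 4 * E ^+ 2 * theta ^+ 2) = 4 * eta * theta * E ^+ 2 by ring.
    by rewrite !mulr_ge0 ?sqr_ge0.
  apply: sum_le_mono (sum_le_inj (addIr (- k)) h) => n /=; set m := n - k.
  rewrite /a rnormZ rnormM rnorm_real ger0_norm // -/m rnorm_tensorE !exprMn.
  set q := rnorm (_ - 1).
  have V2 : rnorm (P (delta R k) x) ^+ 2 <= rnorm x ^+ 2 by rewrite lerXn2r ?nnegrE ?rnorm_ge0.
  apply: (@le_trans _ _ (q ^+ 2 * phi m ^+ 2 * rnorm x ^+ 2)).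
    by rewrite ler_wpM2l // mulr_ge0 ?sqr_ge0.
  have q0 : 0 <= q by exact: rnorm_ge0.
  have w0 : 0 <= phi m ^+ 2 * rnorm x ^+ 2 by rewrite mulr_ge0 ?sqr_ge0.
  rewrite -mulrA; case: ifPn => mG.
    rewrite mulr0 addr0 ler_wpM2r //; apply: lerXn2r; rewrite ?nnegrE //.
    exact: ratio1.
  have q2 : q <= 2 by rewrite (le_trans (rnormB _ _)) // rnorm_ratio rnorm1.
  have q4 : q ^+ 2 <= 4.
    have -> : 4 = 2 ^+ 2 :> R by ring.
    by rewrite lerXn2r ?nnegrE.
  rewrite -[4 * _ * _]mulrA [rnorm x ^+ 2 * _]mulrC -mulrDl ler_wpM2r //.
  by rewrite (le_trans q4) // lerDr sqr_ge0.
have bE : sum_le (fun n => rnorm (b n) ^+ 2) ((rho * E) ^+ 2).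
  rewrite exprMn; apply: sum_le_mono (sum_leZ (sqr_ge0 rho) (@sum_le_rnorm_l2 _ _ _ (tensor x))) => n.
  rewrite /b -rmorphB rnormZ rnorm_real rnorm_tensorE -exprMn lerXn2r ?nnegrE ?mulr_ge0 ?rnorm_ge0 //.
  by rewrite mulrA ler_pM ?rnorm_ge0.
have -> : twist L L' P k (tensor x) - tensor (P (delta R k) x) = l2_of a + l2_of b.
  apply: l2_eqP => n; rewrite !l2E_add (l2_ofE _ aE) (l2_ofE _ bE) l2E_opp.
  rewrite (twistE _ ipP PP) !tensorE (rep_scale PP); last exact: l1_delta.
  by rewrite /a /b scalerA -!scalerBl -scalerDl; congr (_ *: _); ring.
rewrite (le_trans (rnormD _ _)) // mulrDl lerD //; apply: rnorm_l2_le.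
- by rewrite mulr_ge0 // addr_ge0 // mulr_ge0.
- by apply: (sum_le_mono _ aE) => n; rewrite (l2_ofE _ aE).
- by rewrite mulr_ge0.
- by apply: (sum_le_mono _ bE) => n; rewrite (l2_ofE _ bE).
Qed.

End twist_tensor.
End tensor.

Section norm_comparison.
Variables (R : realType) (d : nat).

(** If the cocycles of [L] and [L'] are close on a large finite set, every
    representation [P] for [L] is nearly a compression of its twist to [L'],
    along an almost invariant vector of the regular representation. *)
Theorem universal_norm_close (a : lattice d -> R[i]) (eps : R) : l1 a -> 0 < eps ->
  exists (F G : {fset lattice d}) (eta : R), 0 < eta /\
    forall L L' : 'M[R]_(d + d),
      (forall k n, k \in F -> n \in G ->
         rnorm (lattice_cocycle L' k n - lattice_cocycle L k n) <= eta) ->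
      universal_norm L a <= universal_norm L' a + eps.
Proof.
move=> /[dup] al /l1P[C aC] eps0; have C0 := sum_le_ge0 aC.
have e8 : 0 < eps / 8 by rewrite divr_gt0.
have [F hF] := sum_le_tail (fun i => rnorm_ge0 (a i)) aC e8.
have C1 : 0 < C + 1 by rewrite ltr_wpDl.
pose rho := eps / 8 / (C + 1); have rho0 : 0 < rho by rewrite divr_gt0.
have Cr : C * rho <= eps / 8.
  by rewrite /rho mulrCA ler_piMr ?(ltW e8) // ler_pdivrMr // mul1r lerDl.
have [phi [M [phi_ge0 phi0 phiM phi_inv]]] := almost_invariant_vector F rho0.
have th0 : 0 < rho / 2 by rewrite divr_gt0.
have [G hG] := sum_le_tail (fun n => sqr_ge0 (phi n)) phiM (exprn_gt0 2 th0).
exists F, G, rho; split=> // L L' close.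
have U0 := universal_norm_ge0 L' a.
apply: universal_norm_le => [|H ip P x ipP PP x1]; first by rewrite addr_ge0 // ltW.
have ratio1 k n : k \in F -> n \in G -> rnorm (cocycle_ratio L L' k n - 1) <= rho.
  move=> kF nG; rewrite /cocycle_ratio -(mul_conj_lattice_cocycle L k n) -mulrBl.
  by rewrite rnormM rnormJ rnorm_lattice_cocycle mulr1 close.
pose T := tensor phi x; pose E := rnorm T.
have E0 : 0 <= E by exact: rnorm_ge0.
pose P' := integrated (twist L L' P).
have PP' : is_star_rep L' (l2ip ip) P' := twisted_star_rep L' ipP PP.
have ipP' : is_inner_product (@l2ip R (lattice d) H ip) := l2ip_innerP _ ipP.
have hP : has_sum (fun k => a k *: P (delta R k) x) (P a x).
  apply: (@l1_expansion R d H (P^~ x) (rnorm x)) => // [l b c bl cl|b D bD].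
    exact: (rep_linear PP).
  exact: (rep_norm_le ipP PP bD x).
have hT : has_sum (fun k => a k *: tensor phi (P (delta R k) x)) (tensor phi (P a x)).
  have := has_sum_map (tensorD phiM) (tensor_le phiM) hP.
  by apply: eq_has_sum => k; rewrite /comp (tensorZ phiM).
have hP' : has_sum (fun k => a k *: twist L L' P k T) (P' a T).
  by apply: integrated_has_sum => //; exact: twist_contract ipP PP.
have hD : has_sum (fun k => a k *: (twist L L' P k T - tensor phi (P (delta R k) x)))
    (P' a T - tensor phi (P a x)).
  have := has_sumD hP' (has_sumZ (-1) hT); rewrite scaleN1r.
  by apply: eq_has_sum => k; rewrite scaleN1r scalerBr.
(* The terms with [k \in F] have relative error at most
   [rho + 2 * (rho / 2) + rho], the others at most 2. *)
have bD : sum_le (fun k => rnorm (a k *: (twist L L' P k T - tensor phi (P (delta R k) x))))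
    (E * (3 * rho * C + 2 * (eps / 8))).
  pose tl k : R := if k \in F then 0 else rnorm (a k).
  have tlE : sum_le tl (eps / 8).
    move=> S; rewrite (big_fsetID _ (mem F)) /= [X in X + _]big1_fset ?add0r => [|n]; last first.
      by rewrite /tl !inE => /andP[_ /= ->].
    have dj : [disjoint F & [fset n in S | n \notin F]]%fset.
      by apply/fdisjointP => n nF; rewrite !inE nF andbF.
    apply: le_trans (hF _ dj); rewrite le_eqVlt; apply/orP; left; apply/eqP.
    by apply: eq_fbigr => n; rewrite /tl !inE => /andP[_ /negPf ->].
  have k0 : 0 <= 3 * rho by rewrite mulr_ge0 ?ltW.
  have h := sum_leZ E0 (sum_leD (sum_leZ k0 aC) (sum_leZ (ler0n R 2) tlE)).
  apply: (sum_le_mono _ h) => k; rewrite rnormZ mulrC /tl.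
  case: ifPn => kF.
    rewrite mulr0 addr0 mulrA ler_wpM2r ?rnorm_ge0 //.
    have := twist_tensor phi_ge0 phi0 phiM ipP PP (ltW rho0) (ltW th0)
      (fun n => phi_inv k n kF) hG (fun n nG => ratio1 k n kF nG) x.
    have -> : rho + 2 * (rho / 2) + rho = 3 * rho by field.
    by rewrite mulrC.
  rewrite -mulrDl mulrA ler_wpM2r ?rnorm_ge0 //.
  apply: (@le_trans _ _ (E + E)).
    apply: (le_trans (rnormB _ _)); apply: lerD.
      exact: (@twist_contract _ _ L L' _ _ _ ipP PP k T).
    apply: tensor_mono => //; exact: (V_contract ipP PP k x).
  have -> : E + E = E * 2 by ring.
  by rewrite ler_wpM2l // lerDr.
have D := has_sum_le bD hD.
have h1 : rnorm (tensor phi (P a x)) <= E * (universal_norm L' a + eps).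
  have := le_universal_norm T al ipP' PP'.
  have := rdist_tri (tensor phi (P a x)) (P' a T) 0; rewrite !subr0 rdistC => t1 t2.
  apply: (le_trans t1); apply: (le_trans (lerD D t2)); rewrite -/T -/E.
  rewrite [_ * E]mulrC -mulrDr ler_wpM2l //; move: Cr; rewrite [C * rho]mulrC -mulrA; set z := rho * C; lra.
have [x0|x0] := eqVneq (rnorm x) 0.
  have := rep_norm_le ipP PP aC x; rewrite x0 mulr0 => /le_trans; apply.
  by rewrite addr_ge0 // ltW.
have xp : 0 < rnorm x by rewrite lt_def x0 rnorm_ge0.
have Ep : 0 < E.
  by apply: (lt_le_trans xp); exact: (le_tensor phi_ge0 phi0 phiM x).
have h2 := tensor_norm phi_ge0 phiM x (P a x).
rewrite -(ler_pM2l Ep) -h2 (le_trans (ler_wpM2r (ltW xp) h1)) //.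
by rewrite ler_piMr // mulr_ge0 // addr_ge0 // ltW.
Qed.

End norm_comparison.

(** * The Banach bundle spanned by a space of sections *)
Section fiberwise.
Variables (R : realType) (X : topologicalType).
Variable E : X -> completeNormedModType R[i].
Variable tau : topology (total_space E).

Notation nb s A := (@nbhs (tspace tau) (tspace tau) s A).

Lemma tspace_nbhsS (s : total_space E) A B : A `<=` B -> nb s A -> nb s B.
Proof. by move=> AB [Q [oQ Qs QA]]; exists Q; split=> // t /QA /AB. Qed.

Lemma fiberwise_continuousP (op : forall x, E x -> E x -> E x) :
  fiberwise_continuous tau op <->
  (forall x (s t : E x) A, nb (in_total (op x s t)) A ->
     exists B C, [/\ nb (in_total s) B, nb (in_total t) C &
       forall y (s' t' : E y), B (in_total s') -> C (in_total t') ->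
         A (in_total (op y s' t'))]).
Proof.
split=> [cop x s t A An|h].
  have [_ [[Q Qop <-] Qp QA]] := cop (existT _ x (s, t)) A An.
  have : nbhs (fiber_pairs_incl tau (existT _ x (s, t))) Q by exact: open_nbhs_nbhs.
  move=> [[B C] [/= Bn Cn] BCQ]; exists B, C; split=> // y s' t' Bs Ct.
  by apply: (QA (existT _ y (s', t'))); apply: BCQ.
move=> [x [s t]] A An; have [B [C [Bn Cn BC]]] := h x s t A An.
have ic := @initial_continuous (fiber_pairs E) (tspace tau * tspace tau)%type
  (fiber_pairs_incl tau) (existT _ x (s, t)).
have hBC : nbhs (fiber_pairs_incl tau (existT _ x (s, t))) (B `*` C) by exists (B, C).
have [Q [oQ Qp QBC]] := ic _ hBC; exists Q; split=> // -[y [s' t']] /QBC [/= ? ?].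
exact: BC.
Qed.

End fiberwise.

Lemma nbhs_open (X : topologicalType) (x : X) (P : set X) :
  nbhs x P -> exists U, [/\ open U, U x & U `<=` P].
Proof. by rewrite nbhsE => -[U [oU Ux] UP]; exists U. Qed.

Section fell.
Variables (R : realType) (X : topologicalType).
Variable E : X -> completeNormedModType R[i].
Variables (J : Type) (D : set J) (sec : forall x, J -> E x).

Definition basic_set (a : J) (U : set X) (e : R) : set (total_space E) :=
  [set s | U (rho s) /\ rnorm (projT2 s - sec (projT1 s) a) < e].

Definition basic_sets : set (set (total_space E)) :=
  [set W | exists a U e, [/\ D a, open U, 0 < e & W = basic_set a U e]].

Definition fell_opens : set (set (total_space E)) :=
  [set O | forall s, O s -> exists W, [/\ basic_sets W, W s & W `<=` O]].

Hypothesis D_linear : forall (l : R[i]) a b, D a -> D b ->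
  exists2 c, D c & forall x, sec x c = l *: sec x a + sec x b.
Hypothesis D_norm : forall a, D a -> continuous (fun x => rnorm (sec x a)).
Hypothesis D_dense : forall x, dense (sec x @` D).

Lemma section_approx x (s : E x) (e : R) : 0 < e -> exists2 a, D a & rnorm (s - sec x a) < e.
Proof.
move=> e0; have := @D_dense x (ball s (real_complex R e)).
case=> [| |y [/ball_rnorm h [a Da ay]]].
- by exists s; apply: ballxx; rewrite ltcR.
- by apply: ball_open; rewrite ltcR.
- by exists a => //; rewrite ay.
Qed.

Lemma D_dist_lt a b x0 (r : R) : D a -> D b -> rnorm (sec x0 a - sec x0 b) < r ->
  exists V, [/\ open V, V x0 & forall x, V x -> rnorm (sec x a - sec x b) < r].
Proof.
move=> Da Db h; have [c Dc cE] := D_linear (-1) Db Da.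
exists ((fun x => rnorm (sec x c)) @^-1` [set y | y < r]); split.
- by move/continuousP: (D_norm Dc); apply; exact: open_lt.
- by rewrite /= cE scaleN1r addrC.
- by move=> x /=; rewrite cE scaleN1r addrC.
Qed.

Lemma D_dist_gt a b x0 (r : R) : D a -> D b -> r < rnorm (sec x0 a - sec x0 b) ->
  exists V, [/\ open V, V x0 & forall x, V x -> r < rnorm (sec x a - sec x b)].
Proof.
move=> Da Db h; have [c Dc cE] := D_linear (-1) Db Da.
exists ((fun x => rnorm (sec x c)) @^-1` [set y | r < y]); split.
- by move/continuousP: (D_norm Dc); apply; exact: open_gt.
- by rewrite /= cE scaleN1r addrC.
- by move=> x /=; rewrite cE scaleN1r addrC.
Qed.

(** A basic set contains a basic set around each section passing close to one
    of its points, because the distance of two sections is continuous. *)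
Lemma basic_set_refine a U e (s : total_space E) : D a -> open U -> basic_set a U e s ->
  exists2 eta, 0 < eta & forall c del, D c -> 0 < del -> del <= eta ->
    rnorm (projT2 s - sec (projT1 s) c) < del ->
    exists V, [/\ open V, V (rho s) & basic_set c V del `<=` basic_set a U e].
Proof.
move=> Da oU [Us se]; pose e0 := rnorm (projT2 s - sec (projT1 s) a).
exists ((e - e0) / 2) => [|c del Dc d0 dle sc]; first by rewrite divr_gt0 // subr_gt0.
have h : rnorm (sec (projT1 s) c - sec (projT1 s) a) < e0 + del.
  move: sc (rdist_tri (sec (projT1 s) c) (projT2 s) (sec (projT1 s) a)).
  rewrite [rnorm (sec _ c - projT2 s)]rdistC -/e0; rnlra.
have [V [oV Vs hV]] := D_dist_lt Dc Da h.
exists (U `&` V); split=> //; first exact: openI.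
move=> t [[Ut Vt] tc]; split=> //; have := hV _ Vt; rewrite -/(rho t) in tc *.
move: tc (rdist_tri (projT2 t) (sec (projT1 t) c) (sec (projT1 t) a)).
rewrite /rho; rnlra.
Qed.

Lemma basic_sets_approx (s : total_space E) : exists W, basic_sets W /\ W s.
Proof.
have [a Da h] := section_approx (projT2 s) (@ltr01 R).
exists (basic_set a setT 1); split; last by split.
by exists a, setT, 1; split=> //; exact: openT.
Qed.

Lemma basic_set_open a U e : D a -> open U -> fell_opens (basic_set a U e).
Proof.
move=> Da oU s sW; exists (basic_set a U e); split=> //.
exists a, U, e; split=> //; case: sW => _; apply: le_lt_trans; exact: rnorm_ge0.
Qed.

Lemma fell_opensT : fell_opens setT.
Proof. by move=> s _; have [W [BW Ws]] := basic_sets_approx s; exists W. Qed.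

Lemma fell_opensI : setI_closed fell_opens.
Proof.
move=> O1 O2 h1 h2 s [/h1 [_ [[a1 [U1 [e1 [Da1 oU1 e10 ->]]]] s1 W1]]].
move=> /h2 [_ [[a2 [U2 [e2 [Da2 oU2 e20 ->]]]] s2 W2]].
have [n1 n10 r1] := basic_set_refine Da1 oU1 s1.
have [n2 n20 r2] := basic_set_refine Da2 oU2 s2.
pose del := Num.min n1 n2; have d0 : 0 < del by rewrite lt_min n10.
have [c Dc sc] := section_approx (projT2 s) d0.
have [V1 [oV1 V1s h1']] := r1 c del Dc d0 (ltac:(by rewrite ge_min lexx)) sc.
have [V2 [oV2 V2s h2']] := r2 c del Dc d0 (ltac:(by rewrite ge_min lexx orbT)) sc.
exists (basic_set c (V1 `&` V2) del); split.
- by exists c, (V1 `&` V2), del; split=> //; exact: openI.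
- by [].
- by move=> t [[Vt1 Vt2] tc]; split; [apply/W1/h1'|apply/W2/h2'].
Qed.

Lemma fell_opens_bigU (I : Type) (f : I -> set (total_space E)) :
  (forall i, fell_opens (f i)) -> fell_opens (\bigcup_i f i).
Proof.
move=> h s [i _ fs]; have [W [BW Ws Wf]] := h i s fs.
by exists W; split=> // t /Wf; exists i.
Qed.

Definition fell_topology := Topology fell_opensT fell_opensI fell_opens_bigU.

Notation nb s A := (@nbhs (tspace fell_topology) (tspace fell_topology) s A).

Lemma nbhs_basic c V del (s : total_space E) : D c -> open V -> V (rho s) ->
  rnorm (projT2 s - sec (projT1 s) c) < del -> nb s (basic_set c V del).
Proof. by move=> Dc oV Vs sc; exists (basic_set c V del); split=> //; exact: basic_set_open. Qed.

(** A neighbourhood contains basic ones around any section that passes close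
    enough; this leaves the freedom to choose a section with further properties,
    such as one that approximates the sum or the product of given sections. *)
Lemma nbhs_fell (s : total_space E) A : nb s A ->
  exists2 eta, 0 < eta & forall c del, D c -> 0 < del -> del <= eta ->
    rnorm (projT2 s - sec (projT1 s) c) < del ->
    exists V, [/\ open V, V (rho s) & basic_set c V del `<=` A].
Proof.
move=> [Q [oQ Qs QA]]; have [_ [[a [U [e [Da oU e0 ->]]]] sW WQ]] := oQ s Qs.
have [eta eta0 h] := basic_set_refine Da oU sW; exists eta => // c del Dc d0 dle sc.
have [V [oV Vs VW]] := h c del Dc d0 dle sc; exists V; split=> //.
by move=> t /VW /WQ /QA.
Qed.

Lemma fell_basis : basis (basic_sets : set (set (tspace fell_topology))).
Proof.
split; first by move=> _ [a [U [e [Da oU e0 ->]]]]; exact: basic_set_open.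
move=> s A [Q [oQ Qs QA]]; have [W [BW Ws WQ]] := oQ s Qs.
by exists W => //= t /WQ /QA.
Qed.

Lemma zero_section (x : X) : exists2 c, D c & forall x, sec x c = 0.
Proof.
have [a Da _] := section_approx (0 : E x) (@ltr01 R).
have [c Dc cE] := D_linear (-1) Da Da.
by exists c => // y; rewrite cE scaleN1r addNr.
Qed.

Hypothesis X_hausdorff : hausdorff_space X.

Lemma fell_hausdorff : hausdorff_space (tspace fell_topology).
Proof.
move=> [x s] [y t] cl.
have xy : x = y.
  apply: X_hausdorff => U V /nbhs_open[U' [oU' U'x UU']] /nbhs_open[V' [oV' V'y VV']].
  have [a Da sa] := section_approx s (@ltr01 R); have [b Db tb] := section_approx t (@ltr01 R).
  have n1 := nbhs_basic (s := existT _ x s) Da oU' U'x sa.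
  have n2 := nbhs_basic (s := existT _ y t) Db oV' V'y tb.
  by have [u [[/UU' ? _] [/VV' ? _]]] := cl _ _ n1 n2; exists (rho u).
move: t cl; rewrite -xy {y xy} => t cl.
have [st|st] := eqVneq (rnorm (s - t)) 0.
  by have /eqP := rnorm0_eq0 st; rewrite subr_eq0 => /eqP ->.
have st0 : 0 < rnorm (s - t) by rewrite lt_def st rnorm_ge0.
pose e := rnorm (s - t) / 4; have e0 : 0 < e by rewrite divr_gt0.
have [a Da sa] := section_approx s e0; have [b Db tb] := section_approx t e0.
have ab : 2 * e < rnorm (sec x a - sec x b).
  move: sa tb (rdist_tri s (sec x a) t) (rdist_tri (sec x a) (sec x b) t).
  rewrite [rnorm (sec x b - t)]rdistC /e; rnlra.
have [V [oV Vx hV]] := D_dist_gt Da Db ab.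
have n1 := nbhs_basic (s := existT _ x s) Da oV Vx sa.
have n2 := nbhs_basic (s := existT _ x t) Db oV Vx tb.
have [[z u] [[/= Vz ua] [/= _ ub]]] := cl _ _ n1 n2.
exfalso; move: (hV z Vz) ua ub (rdist_tri (sec z a) u (sec z b)).
rewrite [rnorm (sec z a - u)]rdistC; rnlra.
Qed.

Lemma fell_norm_continuous :
  continuous (@total_norm R X E : tspace fell_topology -> R).
Proof.
move=> p; have FF : Filter (@nbhs (tspace fell_topology) (tspace fell_topology) p).
  exact: nbhs_filter.
apply/(@cvgrPdist_lt R R _ _ FF) => e e0; case: p {FF} => x s.
have e4 : 0 < e / 4 by rewrite divr_gt0.
have [a Da sa] := section_approx s e4.
have /cvgrPdist_lt /(_ _ e4) := D_norm Da (x := x).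
move=> /nbhs_open[V [oV Vx hV]].
have := nbhs_basic (s := existT _ x s) Da oV Vx sa.
apply: tspace_nbhsS => -[y t] [/= Vy ta]; rewrite /total_norm /=.
have h1 := le_lt_trans (ler_rdist _ _) sa; have h2 := le_lt_trans (ler_rdist _ _) ta.
have := hV y Vy; rewrite /= => h3; move: h1 h2 h3; rewrite !ltr_norml.
move=> /andP[? ?] /andP[? ?] /andP[? ?]; apply/andP; split; lra.
Qed.

Lemma fell_add_continuous :
  fiberwise_continuous fell_topology (fun x (s t : E x) => s + t).
Proof.
apply/fiberwise_continuousP => x s t A /nbhs_fell[eta eta0 h].
have e0 : 0 < eta / 2 by rewrite divr_gt0.
have [a Da sa] := section_approx s e0; have [b Db tb] := section_approx t e0.
have [c Dc cE] := D_linear 1 Da Db.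
have key y (s' t' : E y) : rnorm (s' - sec y a) < eta / 2 -> rnorm (t' - sec y b) < eta / 2 ->
    rnorm (s' + t' - sec y c) < eta.
  move=> h1 h2; rewrite cE scale1r opprD addrACA.
  move: h1 h2 (rnormD (s' - sec y a) (t' - sec y b)); rnlra.
have [V [oV Vx VA]] := h c eta Dc eta0 (lexx _) (key x s t sa tb).
exists (basic_set a V (eta / 2)), (basic_set b V (eta / 2)); split.
- exact: (nbhs_basic (s := existT _ x s)).
- exact: (nbhs_basic (s := existT _ x t)).
- by move=> y s' t' [/= Vy h1] [/= _ h2]; apply: VA; split=> //; exact: key.
Qed.

Lemma fell_scale_continuous (l : R[i]) :
  continuous ((fun s : total_space E => in_total (l *: projT2 s))
              : tspace fell_topology -> tspace fell_topology).
Proof.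
move=> [x s] A /nbhs_fell[eta eta0 h].
have l1 : 0 < rnorm l + 1 by rewrite ltr_wpDl // rnorm_ge0.
have e0 : 0 < eta / (rnorm l + 1) by rewrite divr_gt0.
have [a Da sa] := section_approx s e0.
have [z Dz zE] := zero_section x; have [c Dc cE] := D_linear l Da Dz.
have key y (s' : E y) : rnorm (s' - sec y a) < eta / (rnorm l + 1) ->
    rnorm (l *: s' - sec y c) < eta.
  rewrite cE zE addr0 -scalerBr rnormZ ltr_pdivlMr // => h1.
  apply: le_lt_trans h1; rewrite mulrC ler_wpM2l ?rnorm_ge0 // lerDl //.
have [V [oV Vx VA]] := h c eta Dc eta0 (lexx _) (key x s sa).
have := nbhs_basic (s := existT _ x s) Da oV Vx sa.
by apply: tspace_nbhsS => -[y s'] [/= Vy h1]; apply: VA; split=> //; exact: key.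
Qed.

Lemma fell_zero (I : Type) (F : set_system I) (s : I -> tspace fell_topology)
    (x : X) : ProperFilter F ->
  (fun i => rho (s i)) @ F --> x ->
  (fun i => total_norm (s i)) @ F --> (0 : R) ->
  s @ F --> (in_total (0 : E x) : tspace fell_topology).
Proof.
move=> FF Fr Fn A /nbhs_fell[eta eta0 h].
have [z Dz zE] := zero_section x.
have h0 : rnorm ((0 : E x) - sec x z) < eta by rewrite zE subr0 rnorm0.
have [V [oV Vx VA]] := h z eta Dz eta0 (lexx _) h0.
have F1 : F [set i | V (rho (s i))] by apply: Fr; exact: open_nbhs_nbhs.
have /cvgrPdist_lt/(_ _ eta0) F2 := Fn.
apply: filterS2 F1 F2 => i Vi; rewrite sub0r normrN ger0_norm ?rnorm_ge0 // => ni.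
by apply: VA; split=> //; rewrite zE subr0.
Qed.

Theorem fell_banach_bundle : is_banach_bundle fell_topology.
Proof.
split.
- exact: X_hausdorff.
- exact: fell_hausdorff.
- move=> [x s] U /nbhs_open[U' [oU' U'x UU']].
  have [a Da sa] := section_approx s (@ltr01 R).
  have := nbhs_basic (s := existT _ x s) Da oU' U'x sa.
  by apply: tspace_nbhsS => t [/UU'].
- move=> O oO; rewrite openE => _ [s Os <-].
  have [_ [[a [U [e [Da oU e0 ->]]]] [Us _] WO]] := oO s Os.
  apply: (@filterS _ _ _ U); last exact: open_nbhs_nbhs.
  move=> y Uy; exists (in_total (sec y a)) => //; apply: WO; split=> //=.
  by rewrite subrr rnorm0.
- by move=> x; exists (in_total (0 : E x)).
- exact: fell_norm_continuous.
- exact: fell_add_continuous.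
- exact: fell_scale_continuous.
- exact: fell_zero.
Qed.

Lemma fell_section_continuousP (gamma : forall x, E x) :
  continuous_section fell_topology gamma <->
  (forall (eps : R) (x0 : X), 0 < eps -> exists (a0 : J) (U0 : set X),
     [/\ D a0, open U0, U0 x0 & forall x, U0 x -> rnorm (gamma x - sec x a0) < eps]).
Proof.
split=> [cg eps x0 e0|h x0 A /nbhs_fell[eta eta0 hA]].
  have [a Da sa] := section_approx (gamma x0) e0.
  have n := nbhs_basic (s := in_total (gamma x0)) Da (@openT X) I sa.
  have /nbhs_open[U [oU Ux0 hU]] := cg x0 _ n.
  by exists a, U; split=> // x /hU [].
have [a [U [Da oU Ux0 hU]]] := h eta x0 eta0.
have [V [oV Vx VA]] := hA a eta Da eta0 (lexx _) (hU _ Ux0).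
have : nbhs x0 (U `&` V) by apply: open_nbhs_nbhs; split=> //; exact: openI.
by apply: filterS => x [Ux Vx']; apply: VA; split=> //; exact: hU.
Qed.

(** In a Banach bundle in which the sections are continuous, a point close to
    a section is that section plus a point of small norm, and points of small
    norm are close to the zero section. *)
Lemma fell_unique (tau : topology (total_space E)) : is_banach_bundle tau ->
  (forall a, D a -> continuous_section tau (fun x => sec x a)) ->
  opens tau = fell_opens.
Proof.
move=> B secc.
have addP := (fiberwise_continuousP tau (fun x (s t : E x) => s + t)).1 (bundle_add_continuous B).
have small x A : @nbhs (tspace tau) (tspace tau) (in_total (0 : E x)) A ->
  exists V (e : R), [/\ open V, V x, 0 < e &
    forall y (u : E y), V y -> rnorm u < e -> A (in_total u)].
  move=> An; apply: contrapT => nV.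
  pose N (p : set X * R) := [set u : total_space E | p.1 (rho u) /\ total_norm u < p.2].
  pose F : set_system (total_space E) :=
    filter_from [set p : set X * R | [/\ open p.1, p.1 x & 0 < p.2]] N.
  have FF : ProperFilter F.
    apply: filter_from_proper; first apply: filter_from_filter.
    - by exists (setT, 1); split=> //=; exact: openT.
    - move=> [U e] [V f] [/= oU Ux e0] [/= oV Vx f0].
      exists (U `&` V, Num.min e f); first by split=> //=; [exact: openI|rewrite lt_min e0].
      by move=> u [/= [Uu Vu]]; rewrite lt_min => /andP[? ?].
    - move=> [U e] [/= oU Ux e0]; exists (in_total (0 : E x)); split=> //=.
      by rewrite /total_norm /= rnorm0.
  have h : (id : total_space E -> tspace tau) @ F --> (in_total (0 : E x) : tspace tau).
    apply: (bundle_zero B) => [U|].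
      move=> /nbhs_open[U' [oU' U'x UU']]; exists (U', 1); first by split.
      by move=> u [/= /UU'].
    apply/cvgrPdist_lt => e e0; exists (setT, e); first by split=> //=; exact: openT.
    by move=> u [/= _ h]; rewrite sub0r normrN ger0_norm // rnorm_ge0.
  have [[V e] [/= oV Vx e0] VA] := h A An.
  by apply: nV; exists V, e; split=> // y u Vy ue; apply: (VA (in_total u)).
rewrite predeqE => Q; split=> [oQ [x s] Qs|oQ].
  have Qn : @nbhs (tspace tau) (tspace tau) (in_total (s + 0)) Q.
    by rewrite addr0; exists Q; split.
  have [N [M [Nn Mn NM]]] := addP x s 0 Q Qn.
  have [V [e [oV Vx e0 hV]]] := small x M Mn.
  have [N1 [oN1 N1s N1N]] := Nn.
  have Nn' : @nbhs (tspace tau) (tspace tau) (in_total (s + 0)) N1.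
    by rewrite addr0; exists N1; split.
  have [N' [M' [N'n M'n NM']]] := addP x s 0 N1 Nn'.
  have [V' [e' [oV' V'x e'0 hV']]] := small x M' M'n.
  have d0 : 0 < Num.min e e' by rewrite lt_min e0.
  have [a Da sa] := section_approx s d0; move: (sa); rewrite lt_min => /andP[sae sae'].
  have aN : @nbhs (tspace tau) (tspace tau) (in_total (sec x a)) N1.
    exists N1; split=> //; rewrite -[sec x a](addrNK s) addrC.
    have [N2 [oN2 N2s N2N]] := N'n; apply: NM'; first exact: N2N.
    by apply: hV' => //; rewrite rdistC.
  have /nbhs_open[V2 [oV2 V2x hV2]] := secc a Da x _ aN.
  exists (basic_set a (V `&` V2) e); split.
  - by exists a, (V `&` V2), e; split=> //; exact: openI.
  - by [].
  - move=> [y t] [/= [Vy V2y] ta]; rewrite -[t](addrNK (sec y a)) addrC.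
    by apply: NM; [apply: N1N; exact: hV2|exact: hV].
change (@open (tspace tau) Q); rewrite openE => -[x s] Qs.
have [_ [[a [U [e [Da oU e0 ->]]]] [/= Ux sa] WQ]] := oQ _ Qs.
have [z Dz zE] := zero_section x; have [c Dc cE] := D_linear (-1) Da Dz.
have cN y : sec y c = - sec y a by rewrite cE zE scaleN1r addr0.
have nA : @nbhs (tspace tau) (tspace tau) (in_total (s + sec x c))
    [set u | total_norm u < e].
  have hn : nbhs (total_norm (in_total (s + sec x c))) [set r | r < e].
    apply: open_nbhs_nbhs; split; first exact: open_lt.
    by rewrite /total_norm /= cN.
  exact: (bundle_norm_continuous B hn).
have [N [M [Nn Mn NM]]] := addP x s (sec x c) _ nA.
have hM : nbhs x (U `&` [set y | M (in_total (sec y c))]).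
  by apply: filterI; [exact: open_nbhs_nbhs|exact: secc].
have rc := bundle_rho_continuous B; have hr := rc (in_total s) _ hM.
have := @filterI _ _ (@nbhs_filter (tspace tau) (in_total s)) _ _ Nn hr.
apply: tspace_nbhsS => -[y t] [Nt [/= Uy Mc]]; apply: WQ; split=> //=.
by rewrite -cN; exact: (NM y t _ Nt Mc).
Qed.

End fell.

(** * The C*-bundle spanned by a space of sections *)
Section cstar_algebra.
Variables (R : realType) (B : cstarAlgType R).
Implicit Types s t u : B.

Lemma rnorm_cmul s t : rnorm (cmul s t) <= rnorm s * rnorm t.
Proof. by rewrite -lecR rmorphM /= !rnormE cmul_norm. Qed.

Lemma cmulBl s t u : cmul (s - t) u = cmul s u - cmul t u.
Proof. by rewrite cmulDl -[- t]scaleN1r cmulZl scaleN1r. Qed.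

Lemma cmulBr s t u : cmul u (s - t) = cmul u s - cmul u t.
Proof. by rewrite cmulDr -[- t]scaleN1r cmulZr scaleN1r. Qed.

Lemma cstarB s t : cstar (s - t) = cstar s - cstar t.
Proof. by rewrite cstarD -[- t]scaleN1r cstarZ rmorphN rmorph1 scaleN1r. Qed.

Lemma cstar0 : cstar (0 : B) = 0.
Proof. by have := cstarB (0 : B) 0; rewrite !subrr. Qed.

Lemma cmul_sum (I J : Type) (r : seq I) (s : seq J) (u : I -> B) (v : J -> B) :
  cmul (\sum_(i <- r) u i) (\sum_(j <- s) v j) = \sum_(i <- r) \sum_(j <- s) cmul (u i) (v j).
Proof.
have c0l (y : B) : cmul 0 y = 0 by have := cmulBl 0 0 y; rewrite !subrr.
have c0r (y : B) : cmul y 0 = 0 by have := cmulBr 0 0 y; rewrite !subrr.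
have Dl (y : B) : {morph (fun x => cmul x y) : x z / x + z} by move=> x z; exact: cmulDl.
have Dr (y : B) : {morph (fun x => cmul y x) : x z / x + z} by move=> x z; exact: cmulDr.
rewrite (big_morph _ (Dl _) (c0l _)); apply: eq_bigr => i _.
by rewrite (big_morph _ (Dr _) (c0r _)).
Qed.

(** By the C*-identity, [||t||^2 = ||t^* t|| <= ||t^*|| ||t||]. *)
Lemma rnorm_cstar s : rnorm (cstar s) = rnorm s.
Proof.
have le t : rnorm t <= rnorm (cstar t).
  have [t0|t0] := eqVneq (rnorm t) 0; first by rewrite t0 rnorm_ge0.
  have tp : 0 < rnorm t by rewrite lt_def t0 rnorm_ge0.
  rewrite -(ler_pM2r tp) -expr2; apply: le_trans (rnorm_cmul _ _).
  by rewrite -lecR rmorphXn /= !rnormE cstar_norm.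
by apply/eqP; rewrite eq_le le andbT -{2}[s]cstarK le.
Qed.

End cstar_algebra.

Section fell_cstar.
Variables (R : realType) (X : topologicalType).
Variable A : X -> cstarAlgType R.
Variables (J : Type) (D : set J) (sec : forall x, J -> A x).
Hypothesis D_linear : forall (l : R[i]) a b, D a -> D b ->
  exists2 c, D c & forall x, sec x c = l *: sec x a + sec x b.
Hypothesis D_norm : forall a, D a -> continuous (fun x => rnorm (sec x a)).
Hypothesis D_dense : forall x, dense (sec x @` D).
Hypothesis X_hausdorff : hausdorff_space X.
Hypothesis D_mul : forall a b (x0 : X) (e : R), D a -> D b -> 0 < e ->
  exists2 c, D c & \forall x \near x0, rnorm (cmul (sec x a) (sec x b) - sec x c) < e.
Hypothesis D_star : forall a (x0 : X) (e : R), D a -> 0 < e ->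
  exists2 c, D c & \forall x \near x0, rnorm (cstar (sec x a) - sec x c) < e.

Notation tau := (fell_topology D_linear D_norm D_dense).

Lemma near_norm_lt a x (r : R) : D a -> rnorm (sec x a) < r ->
  nbhs x [set y | rnorm (sec y a) < r].
Proof.
move=> Da h.
have hn : nbhs (rnorm (sec x a)) [set t | t < r].
  by apply: open_nbhs_nbhs; split; [exact: open_lt|].
exact: (D_norm Da hn).
Qed.

(** [s' t' - c = s' (t' - b) + (s' - a) b + (a b - c)], where [s'] and [b] stay
    bounded near [x]. *)
Lemma fell_mul_continuous : fiberwise_continuous tau (fun x (s t : A x) => cmul s t).
Proof.
apply/fiberwise_continuousP => x s t B /nbhs_fell[eta eta0 h].
(* [K] bounds the sum of the norms of [s'] and [b], which are at most
   [rnorm s + 2] and [rnorm t + 1]. *)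
pose K := rnorm s + rnorm t + 6.
have K0 : 0 < K by rewrite ltr_wpDl // addr_ge0 ?rnorm_ge0.
pose del := Num.min 1 (eta / 2 / K).
have d0 : 0 < del by rewrite lt_min ltr01 !divr_gt0.
have d1 : del <= 1 by rewrite ge_min lexx.
have dK : del * K <= eta / 2 by rewrite -ler_pdivlMr // ge_min lexx orbT.
have [a Da sa] := section_approx D_dense s d0; have [b Db tb] := section_approx D_dense t d0.
have e0 : 0 < eta / 2 by rewrite divr_gt0.
have [c Dc cx] := D_mul x Da Db e0.
have na : rnorm (sec x a) < rnorm s + 1.
  by move: sa d1 (ler_rdist s (sec x a)); rewrite ler_norml => ? ? /andP[? ?]; lra.
have nb : rnorm (sec x b) < rnorm t + 1.
  by move: tb d1 (ler_rdist t (sec x b)); rewrite ler_norml => ? ? /andP[? ?]; lra.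
have Na : nbhs x [set y | rnorm (sec y a) < rnorm s + 1].
  exact: near_norm_lt.
have Nb : nbhs x [set y | rnorm (sec y b) < rnorm t + 1].
  exact: near_norm_lt.
have [V [oV Vx hV]] := nbhs_open (filterI cx (filterI Na Nb)).
have key y (s' t' : A y) : V y -> rnorm (s' - sec y a) < del -> rnorm (t' - sec y b) < del ->
    rnorm (cmul s' t' - sec y c) < eta.
  move=> /hV[/= h1 [h2 h3]] h4 h5.
  have E : cmul s' t' - sec y c = cmul s' (t' - sec y b) +
     (cmul (s' - sec y a) (sec y b) + (cmul (sec y a) (sec y b) - sec y c)).
    by rewrite cmulBr cmulBl !subrKA.
  rewrite E.
  have n1 := le_trans (rnorm_cmul s' (t' - sec y b)) (ler_wpM2l (rnorm_ge0 s') (ltW h5)).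
  have n2 := le_trans (rnorm_cmul (s' - sec y a) (sec y b)) (ler_wpM2r (rnorm_ge0 (sec y b)) (ltW h4)).
  have n3 : rnorm s' <= rnorm s + 2.
    by move: h4 d1 h2 (ler_rdist s' (sec y a)); rewrite ler_norml => ? ? ? /andP[? ?]; lra.
  have n4 : rnorm s' * del <= (rnorm s + 2) * del by rewrite ler_wpM2r // ltW.
  have n5 : del * rnorm (sec y b) <= del * (rnorm t + 1) by rewrite ler_wpM2l ?ltW.
  have n6 : (rnorm s + 2) * del + del * (rnorm t + 1) <= eta / 2.
    apply: le_trans dK; rewrite mulrC -mulrDr ler_wpM2l ?(ltW d0) // /K; lra.
  move: (rnormD (cmul s' (t' - sec y b)) (cmul (s' - sec y a) (sec y b) + (cmul (sec y a) (sec y b) - sec y c))).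
  move: (rnormD (cmul (s' - sec y a) (sec y b)) (cmul (sec y a) (sec y b) - sec y c)).
  move: n1 n2 n4 n5 n6 h1; rnlra.
have [V' [oV' V'x hV']] := h c eta Dc eta0 (lexx _) (key x s t Vx sa tb).
exists (basic_set sec a (V `&` V') del), (basic_set sec b V del); split.
- by apply: (@nbhs_basic _ _ _ _ _ _ D_linear D_norm D_dense _ _ _ (existT _ x s)) => //; exact: openI.
- exact: (@nbhs_basic _ _ _ _ _ _ D_linear D_norm D_dense _ _ _ (existT _ x t)).
- by move=> y s' t' [/= [Vy V'y] h1] [/= _ h2]; apply: hV'; split=> //; exact: key.
Qed.

Lemma fell_star_continuous :
  continuous ((fun s : total_space A => in_total (cstar (projT2 s) : A (projT1 s)))
              : tspace tau -> tspace tau).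
Proof.
move=> [x s] B /nbhs_fell[eta eta0 h].
have e0 : 0 < eta / 2 by rewrite divr_gt0.
have [a Da sa] := section_approx D_dense s e0.
have [c Dc /nbhs_open[V [oV Vx hV]]] := D_star x Da e0.
have key y (s' : A y) : V y -> rnorm (s' - sec y a) < eta / 2 ->
    rnorm (cstar s' - sec y c) < eta.
  move=> Vy h1; have := hV y Vy; rewrite /= => h2.
  have := rdist_tri (cstar s') (cstar (sec y a)) (sec y c).
  rewrite -cstarB rnorm_cstar; move: h1 h2; rnlra.
have [V' [oV' V'x hV']] := h c eta Dc eta0 (lexx _) (key x s Vx sa).
have := @nbhs_basic _ _ _ _ _ _ D_linear D_norm D_dense _ _ _ (existT _ x s) Da (openI oV oV') (conj Vx V'x) sa.
by apply: tspace_nbhsS => -[y s'] [/= [Vy V'y] h1]; apply: hV'; split=> //; exact: key.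
Qed.

Theorem fell_cstar_bundle : is_cstar_bundle tau.
Proof.
split.
- exact: fell_banach_bundle.
- exact: fell_mul_continuous.
- exact: fell_star_continuous.
Qed.

End fell_cstar.

(** * The bundle of enveloping algebras *)
Section GL_topology.
Variables (R : realType) (d : nat).
Notation GLd := (GL R (d + d)).
Implicit Types (k m : lattice d).

Lemma GL_hausdorff : hausdorff_space GLd.
Proof.
have ic := @initial_continuous GLd 'M[R]_(d + d) set_val.
move=> L L' cl; apply: val_inj; apply: (@norm_hausdorff _ 'M[R]_(d + d)) => U V Un Vn.
by have [K [/= UK VK]] := cl _ _ (ic L U Un) (ic L' V Vn); exists (set_val K).
Qed.

Lemma phase_continuous k m : continuous (fun L : 'M[R]_(d + d) =>
  - \sum_(i < d) usubmx (L *m map_mx (intr : int -> R) k) i ord0 *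
                 dsubmx (L *m map_mx intr m) i ord0).
Proof.
have entry (v : lattice d) i : continuous (fun L : 'M[R]_(d + d) => (L *m map_mx (intr : int -> R) v) i ord0).
  have -> : (fun L : 'M[R]_(d + d) => (L *m map_mx (intr : int -> R) v) i ord0) =
      (fun L : 'M[R]_(d + d) => \sum_j L i j * map_mx (intr : int -> R) v j ord0).
    by apply/funext => L; rewrite mxE.
  move=> L; apply: (@cvg_big _ _ _ _ _ (@add_continuous _) _ (nbhs L) _ _ _ (nbhs_filter L)).
  move=> j _; apply: cvgM; last exact: cvg_cst.
  exact: (@coord_continuous R _ _ i j L).
have uE (v : lattice d) i : continuous (fun L : 'M[R]_(d + d) => usubmx (L *m map_mx (intr : int -> R) v) i ord0).
  have -> : (fun L : 'M[R]_(d + d) => usubmx (L *m map_mx (intr : int -> R) v) i ord0) =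
      (fun L : 'M[R]_(d + d) => (L *m map_mx (intr : int -> R) v) (lshift d i) ord0).
    by apply/funext => L; rewrite mxE.
  exact: entry.
have dE (v : lattice d) i : continuous (fun L : 'M[R]_(d + d) => dsubmx (L *m map_mx (intr : int -> R) v) i ord0).
  have -> : (fun L : 'M[R]_(d + d) => dsubmx (L *m map_mx (intr : int -> R) v) i ord0) =
      (fun L : 'M[R]_(d + d) => (L *m map_mx (intr : int -> R) v) (rshift d i) ord0).
    by apply/funext => L; rewrite mxE.
  exact: entry.
move=> L; apply: (@cvgN _ _ _ _ (nbhs_filter L)).
apply: (@cvg_big _ _ _ _ _ (@add_continuous _) _ (nbhs L) _ _ _ (nbhs_filter L)).
by move=> i _; apply: (@cvgM _ _ _ (nbhs_filter L)); [exact: uE|exact: dE].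
Qed.

Lemma cocycle_near_mx k m (L0 : 'M[R]_(d + d)) (e : R) : 0 < e ->
  \forall L \near L0, rnorm (lattice_cocycle L k m - lattice_cocycle L0 k m) < e.
Proof.
move=> e0; have e2 : 0 < e / 2 by rewrite divr_gt0.
pose t (L : 'M[R]_(d + d)) : R := 2 * pi * (- \sum_(i < d)
  usubmx (L *m map_mx (intr : int -> R) k) i ord0 * dsubmx (L *m map_mx intr m) i ord0).
have ht : t L @[L --> L0] --> t L0.
  exact: (@cvgM _ _ _ (nbhs_filter L0) _ _ _ _ (cvg_cst _) (@phase_continuous k m L0)).
have hc : cos (t L) @[L --> L0] --> cos (t L0).
  exact: (continuous_comp ht (@continuous_cos R (t L0))).
have hs : sin (t L) @[L --> L0] --> sin (t L0).
  exact: (continuous_comp ht (@continuous_sin R (t L0))).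
have nc := (cvgrPdist_lt (FF := nbhs_filter L0) _ _).1 hc _ e2.
have ns := (cvgrPdist_lt (FF := nbhs_filter L0) _ _).1 hs _ e2.
apply: (@filterS2 _ _ (nbhs_filter L0) _ _ _ _ nc ns) => L dc ds.
by rewrite rdistC (le_lt_trans (rnorm_ReIm _)) // (splitr e) ltrD.
Qed.

Lemma cocycle_near k m (L0 : GLd) (e : R) : 0 < e ->
  \forall L \near L0, rnorm (lattice_cocycle (set_val L) k m - lattice_cocycle (set_val L0) k m) < e.
Proof.
move=> e0; have ic := @initial_continuous GLd 'M[R]_(d + d) set_val L0.
exact: (ic _ (cocycle_near_mx k m (set_val L0) e0)).
Qed.

Lemma near_all (I : eqType) (X : topologicalType) (x : X) (s : seq I) (P : I -> set X) :
  (forall i, i \in s -> nbhs x (P i)) ->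
  \forall y \near x, forall i, i \in s -> P i y.
Proof.
elim: s => [|i s IH] h; first exact: nearW.
have h1 := h i (mem_head _ _).
have h2 := IH (fun j js => h j (ltac:(by rewrite inE js orbT))).
apply: filterS2 h1 h2 => y y1 y2 j; rewrite inE => /orP[/eqP ->//|]; exact: y2.
Qed.

Lemma cocycle_near_all (S : seq (lattice d * lattice d)) (L0 : GLd) (e : R) : 0 < e ->
  \forall L \near L0, forall p, p \in S ->
  rnorm (lattice_cocycle (set_val L) p.1 p.2 - lattice_cocycle (set_val L0) p.1 p.2) < e.
Proof. by move=> e0; apply: near_all => p _; exact: cocycle_near. Qed.

End GL_topology.

Section weighted_l1.
Variables (R : realType) (d : nat).
Implicit Types (a b : lattice d -> R[i]) (k : lattice d).

Lemma nu_ge1 k : 1 <= nu R k.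
Proof. by rewrite /nu lerDl sumr_ge0 // => i _; exact: normr_ge0. Qed.

Lemma nu_ge0 k : 0 <= nu R k.
Proof. exact: le_trans ler01 (nu_ge1 k). Qed.

Lemma l1nuP a : l1nu a <-> exists M, sum_le (fun k => rnorm (a k) * nu R k) M.
Proof. exact: (esum_lty (fun k => mulr_ge0 (rnorm_ge0 (a k)) (nu_ge0 k))). Qed.

Lemma l1nu_l1 a : l1nu a -> l1 a.
Proof.
move=> /l1nuP[M aM]; apply/l1P; exists M; apply: sum_le_mono aM => k.
by rewrite ler_peMr ?rnorm_ge0 ?nu_ge1.
Qed.

Lemma l1nu_lin (l : R[i]) a b : l1nu a -> l1nu b -> l1nu (fun k => l * a k + b k).
Proof.
move=> /l1nuP[M aM] /l1nuP[N bN]; apply/l1nuP; exists (rnorm l * M + N).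
apply: sum_le_mono (sum_leD (sum_leZ (rnorm_ge0 l) aM) bN) => k.
by rewrite mulrA -mulrDl -rnormM ler_wpM2r ?nu_ge0 ?rnormD.
Qed.

Lemma l1nu_delta k : l1nu (delta R k).
Proof.
apply/l1nuP; exists (\sum_(n <- [fset k]%fset) rnorm (delta R k n) * nu R n).
apply: sum_le_finite => n; first by rewrite mulr_ge0 ?rnorm_ge0 ?nu_ge0.
by rewrite inE => /delta_eq0 ->; rewrite rnorm0 mul0r.
Qed.

Lemma l1nu_comb (I : Type) (r : seq I) (u : I -> R[i]) (f : I -> lattice d) :
  l1nu (fun n => \sum_(k <- r) u k * delta R (f k) n).
Proof.
elim: r => [|k r IH].
  apply/l1nuP; exists 0 => F; rewrite big1 // => n _; by rewrite big_nil rnorm0 mul0r.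
rewrite (_ : (fun _ => _) = (fun n => u k * delta R (f k) n + \sum_(k <- r) u k * delta R (f k) n)).
  exact: l1nu_lin (l1nu_delta _) IH.
by apply/funext => n; rewrite big_cons.
Qed.

End weighted_l1.

Section enveloping_bundle.
Variables (R : realType) (d : nat) (A : GL R (d + d) -> cstarAlgType R).
Variable iota : forall L : GL R (d + d), (lattice d -> R[i]) -> A L.
Hypothesis A_env : forall L : GL R (d + d), is_enveloping (set_val L) (iota L).
Implicit Types (a b : lattice d -> R[i]) (L : GL R (d + d)) (k m : lattice d).

Notation c L := (lattice_cocycle (set_val L)).

Lemma iota_bound L a C : l1_le a C -> rnorm (iota L a) <= C * 1.
Proof.
move=> aC; rewrite mulr1 (env_norm (A_env L)) ?universal_norm_le_l1 //.
exact: l1_leW aC.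
Qed.

Lemma iota_delta_le1 L k : rnorm (iota L (delta R k)) <= 1.
Proof. by have := iota_bound L (@l1_le_delta R d k); rewrite mulr1. Qed.

Lemma iota_comb L (I : Type) (r : seq I) (u : I -> R[i]) (f : I -> lattice d) :
  iota L (fun n => \sum_(k <- r) u k * delta R (f k) n) =
  \sum_(k <- r) u k *: iota L (delta R (f k)).
Proof. exact: (Q_comb (env_linear (A_env L))). Qed.

Lemma iota_mul_delta L k m :
  cmul (iota L (delta R k)) (iota L (delta R m)) = c L k m *: iota L (delta R (k + m)).
Proof.
rewrite -(env_mul (A_env L)); try exact: l1_delta.
rewrite conv_delta; have := iota_comb L [:: 0] (fun _ : nat => c L k m) (fun _ => k + m).
rewrite big_seq1 => <-; congr (iota L _); apply/funext => n; by rewrite big_seq1.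
Qed.

Lemma iota_star_delta L k : cstar (iota L (delta R k)) = c L k k *: iota L (delta R (- k)).
Proof.
rewrite -(env_star (A_env L)); last exact: l1_delta.
rewrite star_delta; have := iota_comb L [:: 0] (fun _ : nat => c L k k) (fun _ => - k).
rewrite big_seq1 => <-; congr (iota L _); apply/funext => n; by rewrite big_seq1.
Qed.

(** The norm of every [A_L] is dominated by the l1 norm, so that one finite set
    serves all [L]. *)
Lemma iota_truncation a (e : R) : l1 a -> 0 < e ->
  exists F : {fset lattice d}, forall L, rnorm (iota L a - iota L (truncation F a)) <= e.
Proof.
move=> /[dup] al /l1P[C aC] e0.
have [F hF] := sum_le_tail (fun i => rnorm_ge0 (a i)) aC e0.
exists F => L; have := iota_bound L (l1_le_tail hF); rewrite mulr1.
rewrite (env_linear (A_env L)) //; last exact: l1_comb.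
by rewrite scaleN1r addrC.
Qed.

Lemma l1_le_truncation (F : {fset lattice d}) a C : l1_le a C -> l1_le (truncation F a) C.
Proof.
move=> aC; apply: (sum_le_mono _ aC) => k; rewrite truncationE.
by case: ifP => // _; rewrite rnorm0 rnorm_ge0.
Qed.

Lemma l1nu_dense L : dense (iota L @` l1nu).
Proof.
move=> Q Q0 oQ; have [y [Qy [a al ay]]] := env_dense (A_env L) Q0 oQ.
have : nbhs (iota L a) Q by apply: open_nbhs_nbhs; rewrite ay.
move=> /nbhs_ballP[_ /gt0_realP[e e0 ->] hQ].
have [F hF] := iota_truncation al (divr_gt0 e0 (ltr0n R 2)).
exists (iota L (truncation F a)); split; last first.
  by exists (truncation F a) => //; exact: l1nu_comb.
by apply: hQ; apply/ball_rnorm; apply: le_lt_trans (hF L) _; lra.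
Qed.

(** The comparison of norms is used in both directions with the same finite sets
    and tolerance, which do not depend on the matrices. *)
Lemma iota_norm_continuous a : l1nu a -> continuous (fun L => rnorm (iota L a)).
Proof.
move=> /l1nu_l1 al L0; apply/(cvgrPdist_lt (FF := nbhs_filter L0)) => e e0.
have e2 : 0 < e / 2 by rewrite divr_gt0.
have [F [G [eta [eta0 h]]]] := universal_norm_close al e2.
have := cocycle_near_all (F `*` G)%fset L0 eta0.
apply: (@filterS _ _ (nbhs_filter L0)) => L hL.
rewrite !(env_norm (A_env _)) //.
have h1 : universal_norm (set_val L0) a <= universal_norm (set_val L) a + e / 2.
  by apply: h => k n kF nG; apply/ltW; apply: (hL (k, n)); rewrite in_fsetM kF.
have h2 : universal_norm (set_val L) a <= universal_norm (set_val L0) a + e / 2.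
  apply: h => k n kF nG; rewrite rdistC; apply/ltW.
  by apply: (hL (k, n)); rewrite in_fsetM kF.
by move: h1 h2; set u := universal_norm _ _; set v := universal_norm _ _;
  rewrite ltr_norml => ? ?; apply/andP; split; lra.
Qed.

(** For truncations [a'] and [b'], the product is the sum of the
    [a(k) b(m) c_L(k, m) delta_(k+m)]; replacing each [c_L] by [c_L0] gives a
    constant section, close to the product while [L] is close to [L0]. *)
Lemma iota_mul_near a b L0 (e : R) : l1nu a -> l1nu b -> 0 < e ->
  exists2 f, l1nu f & \forall L \near L0, rnorm (cmul (iota L a) (iota L b) - iota L f) < e.
Proof.
move=> /l1nu_l1 al /l1nu_l1 bl e0.
have [M aM] := (l1P a).1 al; have [N bN] := (l1P b).1 bl.
have M0 := sum_le_ge0 aM; have N0 := sum_le_ge0 bN.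
pose e1 := e / 4 / (M + N + M * N + 1).
have D0 : 0 < M + N + M * N + 1 by rewrite ltr_wpDl // !addr_ge0 // mulr_ge0.
have e10 : 0 < e1 by rewrite !divr_gt0.
have eD : e1 * (M + N + M * N + 1) = e / 4 by rewrite /e1 divfK ?gt_eqF.
have [F hF] := iota_truncation al e10; have [G hG] := iota_truncation bl e10.
pose f n := \sum_(p <- (F `*` G)%fset) (a p.1 * b p.2 * c L0 p.1 p.2) * delta R (p.1 + p.2) n.
exists f; first exact: l1nu_comb.
have := cocycle_near_all (F `*` G)%fset L0 e10.
apply: (@filterS _ _ (nbhs_filter L0)) => L hL.
set x := iota L a; set y := iota L b; set x' := iota L (truncation F a).
set y' := iota L (truncation G b); set z := iota L f.
have hx : rnorm (x - x') <= e1 by exact: hF.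
have hy : rnorm (y - y') <= e1 by exact: hG.
have nx' : rnorm x' <= M by have := iota_bound L (l1_le_truncation F aM); rewrite mulr1.
have ny : rnorm y <= N by have := iota_bound L bN; rewrite mulr1.
have E : cmul x y - z = cmul (x - x') y + (cmul x' (y - y') + (cmul x' y' - z)).
  by rewrite cmulBl cmulBr !subrKA.
have h1 : rnorm (cmul (x - x') y) <= e1 * N.
  by apply: (le_trans (rnorm_cmul _ _)); rewrite ler_pM ?rnorm_ge0.
have h2 : rnorm (cmul x' (y - y')) <= M * e1.
  by apply: (le_trans (rnorm_cmul _ _)); rewrite ler_pM ?rnorm_ge0.
have h3 : rnorm (cmul x' y' - z) <= e1 * (M * N).
  have -> : cmul x' y' - z = \sum_(p <- (F `*` G)%fset)
     (a p.1 * b p.2 * (c L p.1 p.2 - c L0 p.1 p.2)) *: iota L (delta R (p.1 + p.2)).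
    rewrite /x' /y' /z /f !iota_comb cmul_sum.
    rewrite -(big_fsetM (fun p => cmul (a p.1 *: iota L (delta R p.1)) (b p.2 *: iota L (delta R p.2)))).
    rewrite -sumrB; apply: eq_bigr => p _.
    by rewrite cmulZl cmulZr iota_mul_delta !scalerA -scalerBl mulrBr.
  apply: (le_trans (rnorm_sum _ _ _)).
  have ab := sum_le_prod (fun k => rnorm_ge0 (a k)) (fun k => rnorm_ge0 (b k)) aM bN.
  apply: le_trans (sum_leZ (ltW e10) ab (F `*` G)%fset).
  rewrite big_seq [leRHS]big_seq; apply: ler_sum => p pF.
  rewrite rnormZ !rnormM -[leRHS]mulr1 ler_pM ?iota_delta_le1 ?mulr_ge0 ?rnorm_ge0 //.
  by rewrite mulrC ler_wpM2r ?mulr_ge0 ?rnorm_ge0 // ltW // hL.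
rewrite E.
have t1 := rnormD (cmul (x - x') y) (cmul x' (y - y') + (cmul x' y' - z)).
have t2 := rnormD (cmul x' (y - y')) (cmul x' y' - z).
have : e1 * N + (M * e1 + e1 * (M * N)) <= e / 4.
  by rewrite -eD [M * e1]mulrC -!mulrDr ler_wpM2l ?(ltW e10) //; lra.
move: t1 t2 h1 h2 h3; rnlra.
Qed.

(** As for products, the adjoint of a truncation has finitely many coefficients,
    which are frozen at [L0]. *)
Lemma iota_star_near a L0 (e : R) : l1nu a -> 0 < e ->
  exists2 f, l1nu f & \forall L \near L0, rnorm (cstar (iota L a) - iota L f) < e.
Proof.
move=> /l1nu_l1 al e0; have [M aM] := (l1P a).1 al; have M0 := sum_le_ge0 aM.
pose e1 := e / 4 / (M + 1).
have D0 : 0 < M + 1 by rewrite ltr_wpDl.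
have e10 : 0 < e1 by rewrite !divr_gt0.
have eD : e1 * (M + 1) = e / 4 by rewrite /e1 divfK ?gt_eqF.
have [F hF] := iota_truncation al e10.
pose f n := \sum_(k <- F) ((a k)^* * c L0 k k) * delta R (- k) n.
exists f; first exact: l1nu_comb.
have := cocycle_near_all [seq (k, k) | k <- F] L0 e10.
apply: (@filterS _ _ (nbhs_filter L0)) => L hL.
set x := iota L a; set x' := iota L (truncation F a); set z := iota L f.
have h1 : rnorm (cstar x - cstar x') <= e1 by rewrite -cstarB rnorm_cstar; exact: hF.
have h2 : rnorm (cstar x' - z) <= e1 * M.
  have -> : cstar x' - z = \sum_(k <- F)
     ((a k)^* * (c L k k - c L0 k k)) *: iota L (delta R (- k)).
    rewrite /x' /z /f !iota_comb (big_morph _ (@cstarD _ _) (@cstar0 _ _)) -sumrB.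
    apply: eq_bigr => k _.
    by rewrite cstarZ iota_star_delta !scalerA -scalerBl mulrBr.
  apply: (le_trans (rnorm_sum _ _ _)); apply: le_trans (sum_leZ (ltW e10) aM F).
  rewrite big_seq [leRHS]big_seq; apply: ler_sum => k kF.
  rewrite rnormZ !rnormM rnormJ -[leRHS]mulr1 ler_pM ?iota_delta_le1 ?mulr_ge0 ?rnorm_ge0 //.
  by rewrite mulrC ler_wpM2r ?rnorm_ge0 // ltW // (hL (k, k)) // map_f.
have := rdist_tri (cstar x) (cstar x') z.
move: h1 h2 eD; rewrite mulrDr mulr1; set w := e1 * M; rnlra.
Qed.

Lemma iota_lin (l : R[i]) a b : l1nu a -> l1nu b ->
  exists2 f, l1nu f & forall L, iota L f = l *: iota L a + iota L b.
Proof.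
move=> an bn; exists (fun k => l * a k + b k); first exact: l1nu_lin.
by move=> L; rewrite (env_linear (A_env L)) //; exact: l1nu_l1.
Qed.

End enveloping_bundle.

Theorem theorem3p9 (R : realType) (d : nat) (d_ge1 : (1 <= d)%N)
    (A : GL R (d + d) -> cstarAlgType R)
    (iota : forall L : GL R (d + d), (lattice d -> R[i]) -> A L)
    (A_enveloping : forall L : GL R (d + d),
       is_enveloping (set_val L) (iota L)) :
  [/\ forall a : lattice d -> R[i], l1nu a ->
        continuous (fun L : GL R (d + d) => rnorm (iota L a)),
      forall L : GL R (d + d), dense (iota L @` l1nu)
    & exists tau : topology (total_space A),
        [/\ basis (Wsets iota : set (set (tspace tau))),
            is_cstar_bundle tau,
            forall a : lattice d -> R[i], l1nu a ->
              continuous_section tau (fun L => iota L a),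
            forall tau' : topology (total_space A),
              is_banach_bundle tau' ->
              (forall a : lattice d -> R[i], l1nu a ->
                 continuous_section tau' (fun L => iota L a)) ->
              opens tau' = opens tau
          & forall gamma : (forall L : GL R (d + d), A L),
              continuous_section tau gamma <->
              (forall (eps : R) (L0 : GL R (d + d)), 0 < eps ->
                 exists (a0 : lattice d -> R[i]) (U0 : set (GL R (d + d))),
                   [/\ l1nu a0, open U0, U0 L0
                     & forall L, U0 L -> rnorm (gamma L - iota L a0) < eps])]].
Proof.
have nc := iota_norm_continuous A_enveloping.
have dn := l1nu_dense A_enveloping.
have ln := iota_lin A_enveloping.
split=> //; exists (fell_topology ln nc dn).
have sP := fell_section_continuousP ln nc dn.
split.
- exact: fell_basis.
- apply: fell_cstar_bundle; first exact: GL_hausdorff.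
    exact: iota_mul_near A_enveloping.
  exact: iota_star_near A_enveloping.
- move=> a an; apply/sP => eps L0 e0; exists a, setT; split=> //; first exact: openT.
  by move=> L _; rewrite subrr rnorm0.
- move=> tau' B sc; exact: fell_unique B sc.
- exact: sP.
Qed.
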